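(* Let $\zeta\in(-1/2,\infty)$ and $\alpha\in(0,2]$. In what follows, $f\lesssim_{p} g$ means $f\le Kg$ for a constant $K\in(0,\infty)$ depending only on the listed parameters $p$ (and not on the variables $r,s,z,t,\tau$), and $f\sim_p g$ means $f\lesssim_p g\lesssim_p f$. \begin{enumerate} \item Let $0<C\le1$. There are constants $c_1,c_2>0$ depending only on $\zeta$ and $C$ such that for all $z,s>0$ and $\tau\in[C,C^{-1}]$, \[ p_\zeta^{(2)}(1,c_1z,c_1s)\lesssim_{C,\zeta}p_\zeta^{(2)}(\tau,z,s)\lesssim_{C,\zeta}p_\zeta^{(2)}(1,c_2z,c_2s), \] and, if $\alpha<2$, $p_\zeta^{(\alpha)}(\tau,z,s)\sim_{C,\zeta,\alpha}p_\zeta^{(\alpha)}(1,z,s)$. In particular, for $\alpha\in(0,2)$ and all $\tau,z,s,c>0$: $p_\zeta^{(\alpha)}(\tau,cz,cs)\sim_{\zeta,\alpha,c}p_\zeta^{(\alpha)}(\tau,z,s)$ and $p_\zeta^{(\alpha)}(c\tau,z,s)\sim_{\zeta,\alpha,c}p_\zeta^{(\alpha)}(\tau,z,s)$. \item Let $C>0$. There is $c>0$ depending only on $\zeta$ and $C$ such that for all $\tau>0$ and $0<z\le s/2$: \[ p_\zeta^{(\alpha)}(\tau,z,s)\lesssim_{C,\zeta,\alpha}p_\zeta^{(\alpha)}(\tau,c,cs)\mathbf{1}_{\{\tau>C\}}+\Big(\tau^{-1/2}\frac{e^{-cs^2/\tau}}{(\tau+s^2)^{\zeta}}\mathbf{1}_{\alpha=2}+\frac{\tau}{s^{2\zeta+1+\alpha}+\tau^{\frac{2\zeta+1+\alpha}{\alpha}}}\mathbf{1}_{\alpha\in(0,2)}\Big)\mathbf{1}_{\{\tau<C\}},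 \] \[ p_\zeta^{(\alpha)}(\tau,z,s)\lesssim_{\zeta,\alpha}\tau^{-1/2}\frac{e^{-cs^2/\tau}}{(\tau+s^2)^{\zeta}}\mathbf{1}_{\alpha=2}+\frac{\tau}{s^{2\zeta+1+\alpha}+\tau^{(2\zeta+1+\alpha)/\alpha}}\mathbf{1}_{\alpha\in(0,2)}, \] \[ p_\zeta^{(\alpha)}(\tau,z,s)\lesssim_{\zeta,\alpha}s^{-(2\zeta+1)}. \] \item Let $C>0$. There is $c>0$ depending only on $\zeta$ and $C$ such that for all $0<\tau\le1$, $0<z\le s/2$ with $s\ge C$: $p_\zeta^{(\alpha)}(\tau,z,s)\lesssim_{C,\zeta,\alpha}p_\zeta^{(\alpha)}(1,c,cs)$. \item There is $c>0$ depending only on $\zeta$ and $\alpha$ such that for all $0<r\le s$: $p_\zeta^{(\alpha)}(1,1,s)\lesssim_{\zeta,\alpha}p_\zeta^{(\alpha)}(1,cr,cs)$. In particular, for all $r,s>0$: $\min\{p_\zeta^{(\alpha)}(1,1,r),p_\zeta^{(\alpha)}(1,1,s)\}\lesssim_{\zeta,\alpha}p_\zeta^{(\alpha)}(1,cr,cs)$. \item There is $c>0$ depending only on $\zeta$ and $\alpha$ such that for all $r,s,z,t>0$ with $|z-s|>|r-s|/2$: $p_\zeta^{(\alpha)}(t,z,s)\lesssim_{\zeta,\alpha}p_\zeta^{(\alpha)}(t,cr,cs)$. \end{enumerate}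
   Context: For $\nu\in\mathbb{C}$, $I_\nu$ is the modified Bessel function of the first kind. For $\zeta\in(-1/2,\infty)$, $p_\zeta^{(2)}(t,r,s):=\frac{(rs)^{1/2-\zeta}}{2t}\exp\big(-\frac{r^2+s^2}{4t}\big)I_{\zeta-1/2}\big(\frac{rs}{2t}\big)$ for $r,s,t>0$. For $\alpha\in(0,2)$ and $t>0$, $\sigma_t^{(\alpha/2)}$ is the probability density on $(0,\infty)$ with $e^{-t\lambda^{\alpha/2}}=\int_0^\infty e^{-\tau\lambda}\sigma_t^{(\alpha/2)}(\tau)\,d\tau$ for $\lambda\ge0$, and $p_\zeta^{(\alpha)}(t,r,s):=\int_0^\infty p_\zeta^{(2)}(\tau,r,s)\sigma_t^{(\alpha/2)}(\tau)\,d\tau$. $\mathbf{1}$ denotes an indicator. The constants $c$ in distinct parts (and distinct displayed inequalities) may differ.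
   Formalization: In the first inequality of part 2 the indicator of {τ<C} is read as that of {τ≤C}: as printed, the right side is 0 at τ=C while the left side is positive, so the claim fails there. *)

(* Defs.v *)
From HB Require Import structures.
From mathcomp Require Import all_boot all_order all_algebra.
From mathcomp Require Import all_classical all_reals all_analysis.
Set Implicit Arguments. Unset Strict Implicit. Unset Printing Implicit Defensive.
Import Order.TTheory GRing.Theory Num.Theory.
Import numFieldNormedType.Exports.
Local Open Scope classical_set_scope.
Local Open Scope ring_scope.

Section Defs.
Variable R : realType.

Definition Gamma (x : R) : R :=
  fine (\int[@lebesgue_measure R]_(t in `]0%R, +oo[)
          ((t `^ (x - 1)) * expR (- t))%:E)%E.

Definition besselI (nu x : R) : R :=
  limn (series (fun k : nat =>
    ((x / 2) `^ (2 * k%:R + nu)) / ((k`!)%:R * Gamma (k%:R + nu + 1)))).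

Definition p2 (zeta t r s : R) : R :=
  (r * s) `^ (2^-1 - zeta) / (2 * t) * expR (- (r ^+ 2 + s ^+ 2) / (4 * t))
  * besselI (zeta - 2^-1) (r * s / (2 * t)).

(* sigma is (a version of) the density on (0,oo) of the (beta)-stable
   subordinator at times t > 0:  e^{-t lambda^beta} = int_0^oo e^{-tau lambda} sigma_t(tau) dtau. *)
Definition subordinator_density (beta : R) (sigma : R -> R -> R) : Prop :=
  forall t : R, 0 < t ->
    [/\ measurable_fun (`]0%R, +oo[ : set R) (sigma t),
        (forall tau : R, 0 < tau -> 0 <= sigma t tau),
        (\int[@lebesgue_measure R]_(tau in `]0%R, +oo[) (sigma t tau)%:E = 1%E)%E &
        forall lambda : R, 0 <= lambda ->
          (\int[@lebesgue_measure R]_(tau in `]0%R, +oo[)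
             (expR (- (tau * lambda)) * sigma t tau)%:E
           = (expR (- (t * lambda `^ beta)))%:E)%E].

(* p^(alpha)_zeta(t, r, s); for alpha = 2 it is p^(2), for alpha in (0,2) it is
   the subordinated kernel int_0^oo p^(2)(tau,r,s) sigma_t(tau) dtau
   (this integral is finite for t, r, s > 0). *)
Definition palpha (alpha : R) (sigma : R -> R -> R) (zeta t r s : R) : R :=
  if alpha == 2 then p2 zeta t r s
  else fine (\int[@lebesgue_measure R]_(tau in `]0%R, +oo[)
               (p2 zeta tau r s * sigma t tau)%:E)%E.

Definition admissible (alpha : R) (sigma : R -> R -> R) : Prop :=
  0 < alpha <= 2 /\ (alpha < 2 -> subordinator_density (alpha / 2) sigma).

End Defs.

Section Bound.
Variable R : realType.
Definition model_bound (zeta alpha c tau s : R) : R :=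
  if alpha == 2 then
    tau `^ (- 2^-1) * expR (- (c * s ^+ 2 / tau)) / (tau + s ^+ 2) `^ zeta
  else
    tau / (s `^ (2 * zeta + 1 + alpha) + tau `^ ((2 * zeta + 1 + alpha) / alpha)).
End Bound.

(* Main.v *)
Require Import Defs.
From HB Require Import structures.
From mathcomp Require Import all_boot all_order all_algebra.
From mathcomp Require Import all_classical all_reals all_analysis.
From mathcomp Require Import measurable_realfun ring lra zify.
Import Order.TTheory GRing.Theory Num.Theory.
Import numFieldNormedType.Exports.
Set Implicit Arguments.
Unset Strict Implicit.
Unset Printing Implicit Defensive.
Local Open Scope classical_set_scope.
Local Open Scope ring_scope.

(** Everything reduces to two-sided bounds by explicit functions.  With
    [Phi T x = T^(-1/2) (T + x)^(-zeta)],
      [p2 t r s ~ Phi t (r s) exp (- (r - s)^2 / (4 t))], and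
      [palpha t r s ~ t T^(-alpha/2) Phi T (r s)], [T = max (r - s)^2 t^(2/alpha)].
    The first bound comes from the power series of [I_(zeta - 1/2)]: the ratio
    of its coefficients to those of [sum_k (2k+1)^(-zeta) x^(2k) / (2k)!] changes
    by a factor [1 + O(k^-2)] from one index to the next, and the latter sum is
    [e^x (1 + x)^(-zeta)] up to constants by first and negative moment bounds
    for the Poisson law.  The second bound uses the stable density only through
    its Laplace transform, by dominating or minorising [p2] as a function of
    time by linear combinations of exponentials.  All five parts then
    become elementary comparisons of the explicit functions. *)

(** * Powers and the function Phi *)

(** Negative [zeta] is allowed, so [(T + x)^(-zeta)] may grow with [T]. Because [zeta > -1/2], the
    factor [T^(-1/2)] outweighs this growth and [Phi] still decreases in [T]; kernels can then be
    compared with control of the times from one side only. The shape of the stable model comes from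
    a heuristic: the subordinator at time [t] has typical size [t^(2/alpha)], it exceeds a larger
    level [T] with probability of order [t T^(-alpha/2)], and it must reach about [(r - s)^2] before
    the Gaussian factor stops being small. The model is this probability times the heat kernel at
    time [T]. For [alpha = 2] a constant factor in the exponent cannot be hidden in a multiplicative
    constant. Constants such as [1/32] are simply small enough for a quadratic inequality. For
    [alpha < 2] everything is polynomial and the same [c] does no harm. *)

Section PowerEstimates.
Context {R : realType}.
Implicit Types a b x y z m T L zeta : R.

(** Both comparisons are assumed so that the sign of [z] does not matter: [z >= 0] uses the first,
    [z < 0] the second after inversion. *)
Lemma powR_le_scale a b L z : 0 < a -> 0 < b -> a <= L * b -> b <= L * a ->
  a `^ z <= L `^ `|z| * b `^ z.
Proof.
move=> a0 b0 ab ba.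
have L0 : 0 < L by have : 0 < L * b by [exact: lt_le_trans ab]; rewrite pmulr_lgt0.
have [z0|z0] := leP 0 z.
  by rewrite ger0_norm// -powRM ?(ltW L0) ?(ltW b0)// ge0_ler_powR// nnegrE ltW// mulr_gt0.
have bz : b `^ (- z) <= L `^ (- z) * a `^ (- z).
  by rewrite -powRM ?ge0_ler_powR// ?nnegrE ?oppr_ge0 ltW// mulr_gt0.
rewrite ltr0_norm// -[a `^ _]invrK -[b `^ _]invrK -(powRN a z) -(powRN b z).
by rewrite ler_pdivlMr ?powR_gt0// mulrC ler_pdivrMr ?powR_gt0.
Qed.

Lemma powR_le_expR m x : 0 < x ->
  exists2 K : R, 0 < K & forall u, 0 <= u -> (1 + u) `^ m <= K * expR (x * u).
Proof.
(* A positive exponent [q >= m] replaces [m]. The bound is the tangent line inequality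
   [ln w <= w - 1] at [w = a (1 + u)], multiplied by [q]; since [q a = x], this gives the
   constant. *)
move=> x0; pose q := `|m| + 1; have q0 : 0 < q by rewrite ltr_wpDl.
pose a := x / q; have a0 : 0 < a by rewrite divr_gt0.
exists (expR (x - q - q * ln a)); first exact: expR_gt0.
move=> u u0; have u1 : 0 < 1 + u by rewrite ltr_pwDl.
apply: (@le_trans _ _ ((1 + u) `^ q)).
  apply: ler_powR; first by rewrite lerDl.
  by rewrite (le_trans (ler_norm m))// lerDl.
rewrite /powR gt_eqF// -expRD ler_expR.
have : ln (a * (1 + u)) <= a * (1 + u) - 1.
  have au0 : 0 < a * (1 + u) by rewrite mulr_gt0.
  rewrite -[X in ln X](subrKC 1); apply: le_ln1Dx; lra.
rewrite lnM ?posrE// -(ler_pM2l q0).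
suff -> : q * (a * (1 + u) - 1) = x * (1 + u) - q by lra.
by rewrite /a; field; rewrite gt_eqF.
Qed.

Definition Phi zeta T x : R := T `^ (- 2^-1) * (T + x) `^ (- zeta).

Lemma Phi_gt0 zeta T x : 0 < T -> 0 <= x -> 0 < Phi zeta T x.
Proof. by move=> T0 x0; rewrite mulr_gt0// powR_gt0// ltr_wpDr. Qed.

Lemma Phi_arg zeta T x y L : 0 < T -> 0 <= x -> 0 <= y -> 0 <= L ->
  x <= L * (T + y) -> y <= L * (T + x) ->
  Phi zeta T x <= (1 + L) `^ `|zeta| * Phi zeta T y.
Proof.
move=> T0 x0 y0 L0 xy yx; rewrite /Phi mulrCA ler_wpM2l ?powR_ge0//.
rewrite -(normrN zeta); apply: powR_le_scale; nra.
Qed.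

(** For [zeta < 0] the second factor grows by at most [(T1 / T2)^(-zeta)], and [-zeta < 1/2] lets
    the gain [(T1 / T2)^(-1/2)] of the first factor absorb it. *)
Lemma Phi_decr zeta T1 T2 x : - 2^-1 < zeta -> 0 < T2 -> T2 <= T1 -> 0 <= x ->
  Phi zeta T1 x <= Phi zeta T2 x.
Proof.
move=> hz T20 T21 x0; have T10 : 0 < T1 by exact: lt_le_trans T21.
have [z0|z0] := leP 0 zeta.
  rewrite /Phi !powRN ler_pM ?invr_ge0 ?powR_ge0// lef_pV2 ?posrE ?powR_gt0 ?ltr_wpDr//;
  apply: ge0_ler_powR; rewrite // ?nnegrE; lra.
have le : (T1 + x) `^ (- zeta) <= (T1 / T2) `^ (- zeta) * (T2 + x) `^ (- zeta).
  rewrite -powRM; [|by rewrite divr_ge0 ?ltW|lra].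
  have E : T1 / T2 * (T2 + x) = T1 + T1 / T2 * x by field; rewrite gt_eqF.
  have r1 : 1 <= T1 / T2 by rewrite ler_pdivlMr ?mul1r.
  apply: ge0_ler_powR; rewrite ?nnegrE ?E; nra.
rewrite /Phi (le_trans (ler_wpM2l (powR_ge0 _ _) le))// mulrA ler_wpM2r ?powR_ge0//.
have T1E : T1 = (T1 / T2) * T2 by field; rewrite gt_eqF.
have r1 : 1 <= T1 / T2 by rewrite ler_pdivlMr ?mul1r.
have r0 : 0 < T1 / T2 by rewrite divr_gt0.
rewrite [in X in X * _]T1E powRM; [|exact: ltW..].
rewrite mulrAC -powRD ?(gt_eqF r0) ?implybT// ler_piMl ?powR_ge0//.
by rewrite -[leRHS](powRr0 (T1 / T2)) ler_powR//; lra.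
Qed.

Lemma Phi_time zeta T1 T2 x : 0 < T2 -> T2 <= T1 -> 0 <= x ->
  Phi zeta T2 x <= (T1 / T2) `^ (2^-1 + `|zeta|) * Phi zeta T1 x.
Proof.
move=> T20 T21 x0; have T10 : 0 < T1 by exact: lt_le_trans T21.
have r0 : 0 < T1 / T2 by rewrite divr_gt0.
have r1 : 1 <= T1 / T2 by rewrite ler_pdivlMr ?mul1r.
rewrite powRD ?(gt_eqF r0) ?implybT// /Phi mulrACA ler_pM ?powR_ge0//.
  rewrite -[X in (T1 / T2) `^ X](@gtr0_norm _ 2^-1)// -(normrN 2^-1).
  apply: powR_le_scale => //; first by nra.
  by rewrite divfK ?gt_eqF.
rewrite -(normrN zeta); apply: powR_le_scale; try nra.
have E : T1 / T2 * (T2 + x) = T1 + T1 / T2 * x by field; rewrite gt_eqF.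
by rewrite E; nra.
Qed.

(** No upper bound of [T1] by [T2] is required: the time is first raised from [T1] to [L T1] at a
    polynomial cost, then lowered to [T2] for free by monotonicity. *)
Lemma Phi_le zeta L : - 2^-1 < zeta -> 1 <= L ->
  exists2 K : R, 0 < K & forall T1 T2 x y, 0 < T1 -> 0 < T2 -> 0 <= x -> 0 <= y ->
    T2 <= L * T1 -> x <= L * (T1 + y) -> y <= L * (T1 + x) ->
    Phi zeta T1 x <= K * Phi zeta T2 y.
Proof.
move=> hz L1; have L0 : 0 < L by exact: lt_le_trans L1.
exists ((1 + L) `^ `|zeta| * L `^ (2^-1 + `|zeta|)).
  by rewrite mulr_gt0 ?powR_gt0//; lra.
move=> T1 T2 x y T10 T20 x0 y0 T21 xy yx.
apply: (le_trans (Phi_arg _ T10 x0 y0 (ltW L0) xy yx)).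
rewrite -mulrA ler_wpM2l ?powR_ge0//.
apply: (le_trans (@Phi_time zeta (L * T1) T1 y T10 _ y0)); first by nra.
rewrite mulfK ?gt_eqF// ler_wpM2l ?powR_ge0// Phi_decr//.
Qed.

End PowerEstimates.

(** * The Gamma function *)

Section GammaFunction.
Context {R : realType}.
Local Notation mu := (@lebesgue_measure R).
Implicit Types x y t a b : R.

Let gam y t : R := t `^ (y - 1) * expR (- t).

Let gam_ge0 y t : 0 <= gam y t.
Proof. by rewrite mulr_ge0 ?powR_ge0 ?expR_ge0. Qed.

Let measurable_gam y (D : set R) : measurable_fun D (gam y).
Proof.
apply: measurable_funTS; apply: measurable_funM; first exact: measurable_powR.
by apply: measurableT_comp => //; exact: measurable_funN.
Qed.

Let measurable_Egam y (D : set R) : measurable_fun D (fun t => (gam y t)%:E).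
Proof. by apply/measurable_EFinP; exact: measurable_gam. Qed.

#[local] Hint Extern 0 (measurable_fun _ _) => solve [apply: measurable_Egam] : core.

(** Integration by parts is done on these compact intervals, away from the singularity of
    [t^(x - 1)] at 0. The index shifts make the first one [[1, 2]], so none is degenerate. *)
Let segm (n : nat) : set R := `[n.+1%:R^-1, n.+2%:R]%classic.

Let segm_nd : nondecreasing_seq segm.
Proof.
apply/nondecreasing_seqP => n; rewrite subsetEset => t; rewrite /segm/= !in_itv/=.
move=> /andP[lt tu]; apply/andP; split.
  by rewrite (le_trans _ lt)// lef_pV2 ?posrE ?ltr0n// ler_nat.
by rewrite (le_trans tu)// ler_nat.
Qed.

Let segm_cover : \bigcup_n segm n = `]0, +oo[%classic.
Proof.
apply/seteqP; split => t /=; rewrite ?in_itv/= ?andbT.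
  move=> [n _]; rewrite /segm/= in_itv/= => /andP[+ _].
  by apply: lt_le_trans; rewrite invr_gt0.
move=> t0; pose n := Num.bound (t + t^-1).
have tV0 : 0 < t^-1 by rewrite invr_gt0.
have nt : t + t^-1 < n%:R by apply: archi_boundP; rewrite addr_ge0 ?ltW.
exists n => //; rewrite /segm/= in_itv/=; apply/andP; split.
  rewrite -[leRHS]invrK lef_pV2 ?posrE ?ltr0n//.
  by rewrite (@le_trans _ _ n%:R)// ?ler_nat//; lra.
by apply: (@le_trans _ _ n%:R); [lra|rewrite ler_nat; exact: leqW (leqnSn _)].
Qed.

Let cvg_gam y : (\int[mu]_(t in segm n) (gam y t)%:E)%E @[n --> \oo] -->
  (\int[mu]_(t in `]0%R, +oo[) (gam y t)%:E)%E.
Proof.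
rewrite -segm_cover; apply: ge0_nondecreasing_set_cvg_integral.
- exact: segm_nd.
- by move=> n; exact: measurable_itv.
- by move=> n; exact: measurable_Egam.
- by move=> n t _; rewrite lee_fin gam_ge0.
Qed.

Let le_gam y (D : set R) : measurable D -> D `<=` `]0%R, +oo[ ->
  (\int[mu]_(t in D) (gam y t)%:E <= \int[mu]_(t in `]0%R, +oo[) (gam y t)%:E)%E.
Proof.
move=> mD D0; apply: ge0_subset_integral => //.
by move=> t _; rewrite lee_fin gam_ge0.
Qed.

Let continuous_expRN : continuous (fun t => expR (- t) : R).
Proof. by move=> t; apply: continuous_comp; [exact: opp_continuous|exact: continuous_expR]. Qed.

Let is_derive_expRN t : is_derive t 1 (fun t => - expR (- t) : R) (expR (- t)).
Proof.
have -> : expR (- t) = - (expR (- t) * - 1) :> R by rewrite mulrN1 opprK.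
apply: is_deriveN; apply: (@is_derive1_comp _ expR (fun t => - t)).
Qed.

Let gam_parts x a b : 0 < x -> 0 < a -> a < b ->
  (\int[mu]_(t in `[a, b]) (gam (x + 1) t)%:E =
   (a `^ x * expR (- a) - b `^ x * expR (- b))%:E +
   x%:E * \int[mu]_(t in `[a, b]) (gam x t)%:E)%E.
Proof.
move=> x0 a0 ab.
have pos t : t \in `]a, b[ -> 0 < t.
  by rewrite in_itv/= => /andP[at_ _]; exact: lt_trans at_.
have dpow y t : 0 < t -> is_derive t 1 (fun t : R => t `^ y) (y * t `^ (y - 1)).
  by move=> t0; exact: is_derive1_powR.
have cpow y t : 0 < t -> {for t, continuous (fun t : R => t `^ y)}.
  move=> t0; apply: differentiable_continuous; apply/derivable1_diffP.
  by have := dpow y t t0 => /@ex_derive.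
have cexp : continuous (fun t : R => - expR (- t)).
  by move=> t; apply: cvgN; exact: continuous_expRN.
have := @integration_by_parts R (fun t => t `^ x) (fun t => - expR (- t))
  (fun t => x * t `^ (x - 1)) (fun t => expR (- t)) a b ab.
under eq_integral => t _ do rewrite -[X in _ `^ X](addrK 1).
rewrite -/(gam (x + 1)) => ->.
- have -> : (\int[mu]_(t in `[a, b]) (x * t `^ (x - 1) * - expR (- t))%:E =
             - (x%:E * \int[mu]_(t in `[a, b]) (gam x t)%:E))%E.
    rewrite -ge0_integralZl_EFin ?ltW//; last by move=> t _; rewrite lee_fin gam_ge0.
    rewrite -integral_ge0N; last by move=> t _; rewrite mule_ge0// lee_fin ?gam_ge0// ltW.
    by apply: eq_integral => t _; rewrite -EFinM -EFinN mulrN mulrA.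
  by rewrite oppeK; congr (_%:E + _)%E; ring.
- apply: continuous_in_subspaceT => t; rewrite inE/= in_itv/= => /andP[at_ _].
  by apply: cvgM; [exact: cvg_cst|apply: (cpow (x - 1)); exact: lt_le_trans at_].
- split.
  + by move=> t /pos t0; have := dpow x t t0 => /@ex_derive.
  + exact/cvg_at_right_filter/cpow.
  + by apply/cvg_at_left_filter/cpow; exact: lt_trans ab.
- move=> t /pos t0; rewrite derive1E; have := dpow x t t0 => /@derive_val; exact.
- exact: continuous_subspaceT.
- split.
  + by move=> t _; have := is_derive_expRN t => /@ex_derive.
  + exact/cvg_at_right_filter/cexp.
  + exact/cvg_at_left_filter/cexp.
- by move=> t _; rewrite derive1E; have := is_derive_expRN t => /@derive_val; exact.
Qed.

(** Up to the factor [1/2] the integrand is the exponential density of rate [1/2], whose total mass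
    is 1. *)
Let expR_half_lty :
  (\int[mu]_(t in `]0%R, +oo[) (expR (- (2^-1 * t)))%:E < +oo)%E.
Proof.
have E : (\int[mu]_(t in `]0%R, +oo[) (2^-1 * expR (- (2^-1 * t)))%:E <= 1)%E.
  rewrite -(@integral_exponential_pdf R 2^-1)//.
  have -> : (\int[mu]_(t in `]0%R, +oo[) (2^-1 * expR (- (2^-1 * t)))%:E =
      \int[mu]_(t in `]0%R, +oo[) (exponential_pdf 2^-1 t)%:E)%E.
    apply: eq_integral => t; rewrite inE/= in_itv/= andbT => t0.
    by rewrite exponential_pdfE ?ltW// mulNr.
  apply: ge0_subset_integral => //.
    by apply/measurable_EFinP; exact: measurable_exponential_pdf.
  by move=> t _; rewrite lee_fin exponential_pdf_ge0.
move: E; under eq_integral do rewrite EFinM.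
rewrite ge0_integralZl_EFin//; last first.
  apply/measurable_EFinP/measurable_funTS; apply: measurableT_comp => //.
  by apply: measurable_funN; exact: measurable_funM.
rewrite -lee_pdivlMl// ?invr_gt0// => /le_lt_trans; apply.
by rewrite mule1 ltry.
Qed.

Let powR_expRN_le x : 0 < x -> exists2 K : R, 0 < K & forall t, 0 <= t ->
  t `^ x * expR (- t) <= K * expR (- (2^-1 * t)).
Proof.
move=> x0; have h0 : 0 < 2^-1 :> R by [].
have [K K0 hK] := powR_le_expR x h0; exists K => // t t0.
have -> : - (2^-1 * t) = 2^-1 * t + - t by field.
rewrite expRD mulrA ler_wpM2r ?expR_ge0//.
apply: le_trans (hK t t0); apply: ge0_ler_powR; rewrite ?nnegrE; lra.
Qed.

Let gamD1_lty x : 0 < x -> (\int[mu]_(t in `]0%R, +oo[) (gam (x + 1) t)%:E < +oo)%E.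
Proof.
move=> x0; have [K K0 hK] := powR_expRN_le x0.
have mhalf : measurable_fun (`]0%R, +oo[%classic : set R)
    (fun t : R => (expR (- (2^-1 * t)))%:E).
  apply/measurable_EFinP/measurable_funTS; apply: measurableT_comp => //.
  by apply: measurable_funN; exact: measurable_funM.
apply: (@le_lt_trans _ _ (K%:E * \int[mu]_(t in `]0%R, +oo[) (expR (- (2^-1 * t)))%:E)%E).
  rewrite -ge0_integralZl_EFin ?(ltW K0)//.
  apply: ge0_le_integral => //.
  - by move=> t _; rewrite lee_fin gam_ge0.
  - exact: measurable_funeM.
  - move=> t; rewrite /= in_itv/= andbT => t0.
    by rewrite -EFinM lee_fin /gam addrK hK// ltW.
rewrite lte_mul_pinfty// ?lee_fin ?ltW//.
Qed.

Let seg01 n : 0 < n.+1%:R^-1 :> R /\ n.+1%:R^-1 < n.+2%:R :> R.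
Proof.
split; first by rewrite invr_gt0.
rewrite (@le_lt_trans _ _ 1)// ?ltr1n// invf_le1// ?ler1n//.
Qed.

Let segm_sub n : segm n `<=` `]0%R, +oo[.
Proof. by rewrite -segm_cover; exact: bigcup_sup. Qed.

(** For [x < 1] no multiple of an exponential dominates the integrand near 0. Integration by parts
    is read backwards instead: the integral of parameter [x] is controlled by that of parameter
    [x + 1], with boundary terms bounded below by [-K] uniformly in [n]. *)
Let gam_fin x : 0 < x -> (\int[mu]_(t in `]0%R, +oo[) (gam x t)%:E)%E \is a fin_num.
Proof.
move=> x0; have [K K0 hK] := powR_expRN_le x0.
rewrite ge0_fin_numE; last by apply: integral_ge0 => t _; rewrite lee_fin gam_ge0.
have Ifin := gamD1_lty x0.
set I1 := (X in (X < +oo)%E) in Ifin.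
apply: (@le_lt_trans _ _ (x^-1%:E * (I1 + K%:E))%E); last first.
  by rewrite lte_mul_pinfty// ?lee_fin ?invr_ge0 ?ltW// lte_add_pinfty// ltry.
rewrite -(cvg_lim _ (@cvg_gam x))//; apply: lime_le; first exact: cvgP (@cvg_gam x).
apply: nearW => n.
have [a0 ab] := seg01 n.
rewrite -lee_pdivrMl ?invr_gt0// invrK.
have := le_gam (x + 1) (measurable_itv _) (segm_sub (n := n)).
rewrite -/I1 /segm gam_parts// => h.
set J := (X in (_ + X <= _)%E) in h; rewrite -/J.
set A := (X in (X%:E + _ <= _)%E) in h.
have A0 : 0 <= A + K.
  rewrite /A -addrA (le_trans (mulr_ge0 (powR_ge0 n.+1%:R^-1 x) (expR_ge0 (- n.+1%:R^-1))))//.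
  rewrite lerDl addrC subr_ge0 (le_trans (hK _ _))// ler_piMr ?(ltW K0)//.
apply: (@le_trans _ _ ((A + K)%:E + J)%E); first by rewrite leeDr// lee_fin.
by rewrite EFinD addeAC leeD2r.
Qed.

Lemma Gamma_gt0 x : 0 < x -> 0 < Gamma x.
Proof.
(* [fine] sends [+oo] to 0, so positivity of [Gamma] also requires the integral to be finite. *)
move=> x0; rewrite /Gamma fine_gt0//; apply/andP; split; last first.
  by have := gam_fin x0; rewrite fin_numE => /andP[_]; rewrite ltey.
have s12 : (`[1%R, 2%R]%classic : set R) `<=` `]0%R, +oo[%classic.
  by move=> t /=; rewrite !in_itv/= andbT => /andP[t1 _]; exact: lt_le_trans t1.
apply: lt_le_trans (le_gam x (measurable_itv _) s12).
pose c : R := ((2 `^ `|x - 1|)^-1 * expR (- 2)).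
have c0 : 0 < c by rewrite mulr_gt0 ?expR_gt0// invr_gt0 powR_gt0.
apply: (@lt_le_trans _ _ (\int[mu]_(t in `[1%R, 2%R]) (cst c%:E t))%E).
  rewrite integral_cst//= lebesgue_measure_itv/= lte_fin ltr1n -EFinB -EFinM lte_fin.
  by rewrite mulr_gt0// subr_gt0 ltr1n.
apply: ge0_le_integral => //.
  by move=> t _; rewrite lee_fin ltW.
move=> t /=; rewrite in_itv/= => /andP[t1 t2].
have t0 : 0 < t by exact: lt_le_trans t1.
rewrite lee_fin /gam ler_pM ?invr_ge0 ?powR_ge0 ?expR_ge0 ?ler_expR ?lerN2//.
rewrite -div1r ler_pdivrMr ?powR_gt0// mulrC.
have := @powR_le_scale R 1 t 2 (x - 1) ltr01 t0.
by rewrite powR1; apply; lra.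
Qed.

Let tail_cvg0 x : 0 < x ->
  n.+1%:R^-1 `^ x * expR (- n.+1%:R^-1) - n.+2%:R `^ x * expR (- n.+2%:R)
    @[n --> \oo] --> (0 : R).
Proof.
move=> x0; rewrite -[X in _ --> X](subr0 0); apply: cvgB.
  have h : (fun n => n.+1%:R^-1 `^ x) @ \oo --> (0 : R).
    have /cvg_at_rightP := @powR_cvg0 R x x0; apply; split; last exact: cvg_harmonic.
    by move=> n; rewrite invr_gt0.
  apply: (squeeze_cvgr _ (cvg_cst 0) h); apply: nearW => n.
  rewrite mulr_ge0 ?powR_ge0 ?expR_ge0//= ler_piMr ?powR_ge0//.
have [K K0 hK] := powR_expRN_le x0.
have h : (fun n => (K * 2) * n.+1%:R^-1) @ \oo --> (0 : R).
  by rewrite -[X in _ --> X](mulr0 (K * 2)); apply: cvgM; [exact: cvg_cst|exact: cvg_harmonic].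
apply: (squeeze_cvgr _ (cvg_cst 0) h); apply: nearW => n.
rewrite mulr_ge0 ?powR_ge0 ?expR_ge0//= (le_trans (hK _ _))// -mulrA ler_wpM2l ?(ltW K0)//.
rewrite expRN ler_pdivlMr// mulrC ler_pdivrMr ?expR_gt0//.
have := @expR_ge1Dx R (2^-1 * n.+2%:R); rewrite -(natr1 n.+1); lra.
Qed.

Lemma GammaD1 x : 0 < x -> Gamma (x + 1) = x * Gamma x.
Proof.
move=> x0; have x10 : 0 < x + 1 by rewrite ltr_wpDl ?ltW.
have cvg y : 0 < y ->
    fine (\int[mu]_(t in segm n) (gam y t)%:E) @[n --> \oo] --> Gamma y.
  by move=> y0; apply: fine_cvg; rewrite fineK ?gam_fin//; exact: cvg_gam.
have seg_fin n : (\int[mu]_(t in segm n) (gam x t)%:E)%E \is a fin_num.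
  rewrite ge0_fin_numE; last by apply: integral_ge0 => t _; rewrite lee_fin gam_ge0.
  apply: le_lt_trans (le_gam x (measurable_itv _) (segm_sub (n := n))) _.
  by rewrite ltey_eq gam_fin.
have E n : fine (\int[mu]_(t in segm n) (gam (x + 1) t)%:E) =
    n.+1%:R^-1 `^ x * expR (- n.+1%:R^-1) - n.+2%:R `^ x * expR (- n.+2%:R) +
    x * fine (\int[mu]_(t in segm n) (gam x t)%:E).
  have [a0 ab] := seg01 n.
  have := seg_fin n; rewrite /segm (gam_parts x0 a0 ab).
  by case: (\int[mu]_(t in _) _)%E.
move: (cvg _ x10); under eq_fun do rewrite E.
move=> /(cvg_lim (@Rhausdorff R)) <-; rewrite -[RHS]add0r.
apply: cvg_lim => //; apply: cvgD; first exact: tail_cvg0.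
by apply: cvgM; [exact: cvg_cst|exact: cvg].
Qed.

End GammaFunction.

(** * Poisson sums *)

Section BoundedRatio.
Context {R : realType}.

Lemma ln1D_dist (u : R) : - 2^-1 <= u -> `|ln (1 + u) - u| <= 2 * u ^+ 2.
Proof.
move=> u2; have u0 : 0 < 1 + u by lra.
have le1 : ln (1 + u) <= u by apply: le_ln1Dx; lra.
have le2 : u - 2 * u ^+ 2 <= ln (1 + u).
  (* The lower bound is the upper bound [ln (1 + w) <= w] applied to the inverse, with
     [w = - u / (1 + u)]. *)
  have : ln (1 + u)^-1 <= - u / (1 + u).
    rewrite [X in ln X](_ : _ = 1 + (- u / (1 + u))); last by field; rewrite gt_eqF.
    apply: le_ln1Dx; rewrite ltr_pdivlMr//; lra.
  rewrite lnV ?posrE// => h.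
  suff : - u / (1 + u) <= - u + 2 * u ^+ 2 by lra.
  by rewrite ler_pdivrMr//; nra.
by rewrite ler0_norm; lra.
Qed.

(** The right-hand side is an [O(k^-2)] written so that it telescopes, hence [ln r] has bounded
    variation. The step from index 0 to 1 is left out because the logarithmic estimate may fail
    there when [zeta] is near [-1/2]. *)
Lemma bounded_of_ratio (r : nat -> R) (C : R) : (forall k, 0 < r k) ->
  (forall k, `|ln (r k.+2) - ln (r k.+1)| <= C * (k.+1%:R^-1 - k.+2%:R^-1)) ->
  exists2 K : R, 0 < K & forall k, r k <= K /\ 1 <= K * r k.
Proof.
move=> r0 hr.
have C0 : 0 <= C.
  have := le_trans (normr_ge0 _) (hr 0%N); rewrite invr1 pmulr_lge0// subr_gt0.
  by rewrite invf_lt1// ltr1n.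
have step k : `|ln (r k.+1) - ln (r 1%N)| <= C * (1 - k.+1%:R^-1).
  elim: k => [|k IH]; first by rewrite !subrr normr0 invr1 subrr mulr0.
  have -> : ln (r k.+2) - ln (r 1%N) =
    (ln (r k.+2) - ln (r k.+1)) + (ln (r k.+1) - ln (r 1%N)) by ring.
  apply: (le_trans (ler_normD _ _)); apply: (le_trans (lerD (hr k) IH)).
  by rewrite -mulrDr addrC addrA subrK.
pose B : R := `|ln (r 0%N)| + `|ln (r 1%N)| + C.
have lnB k : `|ln (r k)| <= B.
  case: k => [|k]; first by rewrite /B -addrA lerDl addr_ge0.
  have : `|ln (r k.+1)| <= `|ln (r k.+1) - ln (r 1%N)| + `|ln (r 1%N)|.
    by rewrite -{1}[ln (r k.+1)](subrK (ln (r 1%N))) ler_normD.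
  have := step k; have : 0 <= C * k.+1%:R^-1 by rewrite mulr_ge0.
  rewrite mulrBr mulr1; have := normr_ge0 (ln (r 0%N)); rewrite /B.
  move: (C / k.+1%:R) `|ln (r k.+1) - ln (r 1%N)| `|ln (r k.+1)| `|ln (r 1%N)| `|ln (r 0%N)|.
  by move=> *; lra.
exists (expR B) => [|k]; first exact: expR_gt0.
have := lnB k; rewrite ler_norml => /andP[h1 h2].
rewrite -[r k]lnK ?posrE// ler_expR; split => //.
by rewrite -expRD -[leLHS]expR0 ler_expR; lra.
Qed.

End BoundedRatio.

Section PoissonSums.
Context {R : realType}.
Implicit Types x : R.

Lemma sum_exp_coeff_le x N : 0 <= x -> \sum_(0 <= n < N) exp_coeff x n <= expR x.
Proof.
move=> x0; apply: (@nondecreasing_cvgn_le _ (series (exp_coeff x))).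
  apply/nondecreasing_seqP => n; rewrite seriesSr lerDl.
  exact: exp_coeff_ge0.
exact: is_cvg_series_exp_coeff.
Qed.

Lemma exp_coeffS x n : n.+1%:R * exp_coeff x n.+1 = x * exp_coeff x n.
Proof.
rewrite /exp_coeff/= factS natrM exprS.
have : n`!%:R != 0 :> R by rewrite pnatr_eq0 -lt0n fact_gt0.
have : n.+1%:R != 0 :> R by rewrite pnatr_eq0.
by move: n.+1%:R n`!%:R => a b a0 b0; field; rewrite b0 a0.
Qed.

(** This is the Poisson mean [E (N + 1) = 1 + x], with the normalisation [e^x] kept on the right and
    the sum truncated. *)
Lemma sum_mean_le x N : 0 <= x ->
  \sum_(0 <= n < N) exp_coeff x n * (n.+1%:R / (1 + x)) <= expR x.
Proof.
move=> x0; have x1 : 0 < 1 + x by lra.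
under eq_bigr do rewrite mulrA.
rewrite -mulr_suml ler_pdivrMr//.
suff : \sum_(0 <= n < N) exp_coeff x n * n.+1%:R =
    \sum_(0 <= n < N) exp_coeff x n + x * \sum_(0 <= n < N.-1) exp_coeff x n.
  move=> ->; rewrite mulrDr mulr1 [expR x * x]mulrC lerD ?sum_exp_coeff_le//.
  by rewrite ler_wpM2l// sum_exp_coeff_le.
elim: N => [|N IH]; first by rewrite !big_geq// mulr0 addr0.
rewrite !big_nat_recr//= IH; case: N {IH} => [|N].
  by rewrite !big_geq//= ; ring.
rewrite /= !big_nat_recr//= -(natr1 N.+1) mulrDr mulr1.
by rewrite [exp_coeff x N.+1 * _]mulrC exp_coeffS; ring.
Qed.

(** Equivalently, the binomial coefficient of [n + m] over [m] is at most [(n + 1)^m]. It turns a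
    division by [(n + 1)^m] into a shift of the Poisson index by [m]. *)
Lemma fact_add_le n m : ((n + m)`! <= n`! * m`! * n.+1 ^ m)%N.
Proof.
elim: m => [|m IH]; first by rewrite addn0 fact0 !muln1.
rewrite addnS !factS expnS.
apply: (@leq_trans ((m.+1 * n.+1) * (n`! * m`! * n.+1 ^ m))); last by nia.
by apply: leq_mul => //; nia.
Qed.

Lemma sum_exp_coeff_shift_le x m N : 0 <= x ->
  \sum_(0 <= n < N) exp_coeff x (n + m)%N <= expR x.
Proof.
move=> x0; apply: le_trans (sum_exp_coeff_le (N + m) x0).
elim: N => [|N IH]; first by rewrite big_geq// sumr_ge0// => i _; exact: exp_coeff_ge0.
by rewrite addSn !big_nat_recr//= lerD2r.
Qed.

(** For [x > 1], [1 + x <= 2 x] and the factorial bound turn each term into [m! 2^m] times the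
    Poisson weight of index [n + m]. For [x <= 1] the base is at most 2. *)
Lemma sum_neg_moment_le x m N : 0 <= x ->
  \sum_(0 <= n < N) exp_coeff x n * ((1 + x) / n.+1%:R) ^+ m <=
    m`!%:R * 2 ^+ m * expR x.
Proof.
move=> x0; have m1 : 1 <= m`!%:R :> R by rewrite ler1n fact_gt0.
have [x1|x1] := leP x 1.
  apply: (@le_trans _ _ (2 ^+ m * \sum_(0 <= n < N) exp_coeff x n)).
    rewrite mulr_sumr ler_sum// => n _; rewrite mulrC ler_wpM2r ?exp_coeff_ge0//.
    rewrite lerXn2r ?nnegrE// ?divr_ge0//; first by lra.
    rewrite ler_pdivrMr//; have : 1 <= n.+1%:R :> R by rewrite ler1n.
    by lra.
  apply: ler_pM => //; last exact: sum_exp_coeff_le.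
    by apply: sumr_ge0 => i _; exact: exp_coeff_ge0.
  by rewrite ler_peMl.
apply: le_trans (_ : m`!%:R * 2 ^+ m * \sum_(0 <= n < N) exp_coeff x (n + m)%N <= _); last first.
  by rewrite ler_wpM2l// sum_exp_coeff_shift_le.
rewrite mulr_sumr ler_sum// => n _.
rewrite /exp_coeff/= expr_div_n exprD.
have F0 k : 0 < k`!%:R :> R by rewrite ltr0n fact_gt0.
have n0 : 0 < n.+1%:R ^+ m :> R by rewrite exprn_gt0.
have -> : m`!%:R * 2 ^+ m * (x ^+ n * x ^+ m / (n + m)`!%:R) =
  x ^+ n * (2 * x) ^+ m * (m`!%:R / (n + m)`!%:R) by rewrite exprMn; ring.
have -> : x ^+ n / n`!%:R * ((1 + x) ^+ m / n.+1%:R ^+ m) =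
  x ^+ n * (1 + x) ^+ m * (n`!%:R * n.+1%:R ^+ m)^-1.
  by field; rewrite !gt_eqF.
apply: ler_pM.
- by rewrite mulr_ge0// exprn_ge0//; lra.
- by rewrite invr_ge0 mulr_ge0// ltW.
- by rewrite ler_wpM2l ?exprn_ge0// lerXn2r ?nnegrE//; lra.
- rewrite ler_pdivlMr// mulrC ler_pdivrMr ?mulr_gt0//.
  rewrite -natrX -!natrM ler_nat (leq_trans (fact_add_le n m))//.
  by rewrite mulnAC mulnC mulnA.
Qed.

Lemma sum_even_le (f : nat -> R) N : (forall n, 0 <= f n) ->
  \sum_(0 <= k < N) f k.*2 <= \sum_(0 <= n < N.*2) f n.
Proof.
move=> f0; elim: N => [|N IH]; first by rewrite !big_geq.
by rewrite doubleS !big_nat_recr//= -addrA lerD// lerDl.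
Qed.

Lemma sum_even_exp_coeff x N : \sum_(0 <= k < N) exp_coeff x k.*2 =
  2^-1 * (series (exp_coeff x) N.*2 + series (exp_coeff (- x)) N.*2).
Proof.
elim: N => [|N IH]; first by rewrite /series/= !big_geq// addr0 mulr0.
rewrite doubleS !seriesSr big_nat_recr//= IH /exp_coeff/= !exprS.
rewrite -mul2n !exprM sqrrN; field.
by rewrite !pnatr_eq0 -!lt0n !fact_gt0.
Qed.

(** The even part of the exponential series is [cosh x], which is strictly above [e^x / 2];
    strictness makes the bound hold for all large partial sums. *)
Lemma sum_even_ge x : \forall N \near \oo,
  2^-1 * expR x <= \sum_(0 <= k < N) exp_coeff x k.*2.
Proof.
have h : (fun N => \sum_(0 <= k < N) exp_coeff x k.*2) @ \oo -->
    2^-1 * (expR x + expR (- x)).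
  under eq_fun do rewrite sum_even_exp_coeff.
  have dbl : (fun N => N.*2) @ \oo --> \oo.
    apply/cvgnyPge => A; near=> N; apply: (@leq_trans N); last by rewrite -addnn leq_addr.
    by near: N; exact: nbhs_infty_ge.
  have cv y : (fun N => series (exp_coeff y) N.*2) @ \oo --> expR y.
    apply: (@cvg_comp _ _ _ (fun N => N.*2) (series (exp_coeff y)) _ _ _ dbl).
    exact: is_cvg_series_exp_coeff.
  by apply: cvgM; [exact: cvg_cst|apply: cvgD; exact: cv].
have lt : 2^-1 * expR x < 2^-1 * (expR x + expR (- x)).
  by rewrite ltr_pM2l// ltrDl expR_gt0.
near=> N; apply: ltW; near: N.
by apply: (cvgr_gt _ h).
Unshelve. all: by end_near. Qed.

(* The right factor is negative unless both [v] and [v^-1] are at most [M]; a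
   bound linear in [v + v^-1] can be averaged against the Poisson weights. *)
Lemma powR_ge_linear (v M zeta : R) : 0 < v -> 1 <= M ->
  (M `^ `|zeta|)^-1 * (1 - M^-1 * (v + v^-1)) <= v `^ zeta.
Proof.
move=> v0 M1; have M0 : 0 < M by lra.
have vV0 : 0 < v^-1 by rewrite invr_gt0.
have Mz : 0 < M `^ `|zeta| by rewrite powR_gt0.
have [vM|vM] := leP (v + v^-1) M.
  apply: (@le_trans _ _ (M `^ `|zeta|)^-1).
    rewrite ler_piMr ?invr_ge0 ?powR_ge0// lerBlDr lerDl mulr_ge0 ?invr_ge0//; lra.
  rewrite -div1r ler_pdivrMr// mulrC.
  have := @powR_le_scale R 1 v M zeta ltr01 v0; rewrite powR1; apply; last by lra.
  have : M^-1 <= v by rewrite -[v]invrK lef_pV2 ?posrE//; lra.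
  by rewrite -ler_pdivrMl// mulr1.
apply: (@le_trans _ _ 0); last exact: powR_ge0.
rewrite pmulr_rle0 ?invr_gt0// subr_le0 mulrC ler_pdivlMr// mul1r ltW//.
Qed.

(** With [v = (1 + x) / (n + 1)], the three terms on the right are the ones whose Poisson sums are
    already bounded: total mass, negative moment and mean. *)
Lemma powR_le_sum (v zeta : R) (m : nat) : 0 < v -> - 1 <= zeta -> zeta <= m%:R ->
  v `^ zeta <= 1 + v ^+ m + v^-1.
Proof.
move=> v0 z1 zm.
have vm0 : 0 <= v ^+ m by rewrite exprn_ge0// ltW.
have vV0 : 0 < v^-1 by rewrite invr_gt0.
have [v1|/ltW v1] := leP v 1.
  have : v `^ zeta <= v `^ (- 1) by apply: ger_powR => //; rewrite v0.
  by rewrite powR_inv1 ?(ltW v0)//; lra.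
have : v `^ zeta <= v `^ m%:R by exact: ler_powR.
by rewrite powR_mulrn ?(ltW v0)//; lra.
Qed.

Lemma sum_weighted_le (zeta : R) : - 1 <= zeta ->
  exists2 K : R, 0 < K & forall x N, 0 <= x ->
  \sum_(0 <= n < N) exp_coeff x n * ((1 + x) / n.+1%:R) `^ zeta <= K * expR x.
Proof.
move=> z1; pose m := Num.bound `|zeta|.
have hm : zeta <= m%:R by rewrite (le_trans (ler_norm _))// ltW// archi_boundP.
exists (2 + m`!%:R * 2 ^+ m) => [|x N x0]; first by rewrite ltr_pwDl// mulr_ge0.
apply: (@le_trans _ _ (\sum_(0 <= n < N) (exp_coeff x n +
    exp_coeff x n * ((1 + x) / n.+1%:R) ^+ m + exp_coeff x n * (n.+1%:R / (1 + x))))).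
  apply: ler_sum => n _; rewrite -[X in _ <= X + _ + _]mulr1 -!mulrDr.
  rewrite ler_wpM2l ?exp_coeff_ge0// -[n.+1%:R / _]invf_div powR_le_sum//.
  by rewrite divr_gt0//; lra.
rewrite !big_split/=; have := sum_exp_coeff_le N x0; have := sum_mean_le N x0.
by have := sum_neg_moment_le m N x0; rewrite mulrDl; lra.
Qed.

Lemma sum_weighted_ge (zeta : R) : exists2 c : R, 0 < c & forall x, 0 <= x ->
  \forall N \near \oo, c * expR x <=
    \sum_(0 <= k < N) exp_coeff x k.*2 * ((1 + x) / k.*2.+1%:R) `^ zeta.
Proof.
(* The value 12 balances the constants: the even weights have mass at least [1/2], the two error
   sums total at most [2 + 1 = 3], and [1/2 - 3/12 = 1/4]. *)
pose c : R := (12 `^ `|zeta|)^-1; have c0 : 0 < c by rewrite invr_gt0 powR_gt0.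
exists (c / 4) => [|x x0]; first by rewrite divr_gt0.
near=> N.
have e0 n : 0 <= exp_coeff x n by exact: exp_coeff_ge0.
have d0 n : 0 < (1 + x) / n.+1%:R by rewrite divr_gt0//; lra.
apply: (@le_trans _ _ (\sum_(0 <= k < N) c * (exp_coeff x k.*2 -
   12^-1 * (exp_coeff x k.*2 * ((1 + x) / k.*2.+1%:R) ^+ 1 +
            exp_coeff x k.*2 * (k.*2.+1%:R / (1 + x)))))).
  rewrite -mulr_sumr -mulrA ler_wpM2l ?(ltW c0)// sumrB -mulr_sumr big_split/=.
  have S1 : \sum_(0 <= k < N) exp_coeff x k.*2 * ((1 + x) / k.*2.+1%:R) ^+ 1 <= 2 * expR x.
    have := sum_neg_moment_le 1 N.*2 x0; rewrite expr1 mul1r; apply: le_trans.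
    apply: (@sum_even_le (fun n => exp_coeff x n * ((1 + x) / n.+1%:R) ^+ 1)) => n.
    by rewrite mulr_ge0// expr1 ltW.
  have S2 : \sum_(0 <= k < N) exp_coeff x k.*2 * (k.*2.+1%:R / (1 + x)) <= expR x.
    apply: le_trans (sum_mean_le N.*2 x0).
    apply: (@sum_even_le (fun n => exp_coeff x n * (n.+1%:R / (1 + x)))) => n.
    by rewrite mulr_ge0// divr_ge0//; lra.
  have S3 : 2^-1 * expR x <= \sum_(0 <= k < N) exp_coeff x k.*2.
    by near: N; exact: sum_even_ge.
  by lra.
apply: ler_sum => k _.
have -> : c * (exp_coeff x k.*2 - 12^-1 * (exp_coeff x k.*2 * ((1 + x) / k.*2.+1%:R) ^+ 1 +
            exp_coeff x k.*2 * (k.*2.+1%:R / (1 + x)))) =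
    exp_coeff x k.*2 * (c * (1 - 12^-1 * ((1 + x) / k.*2.+1%:R + k.*2.+1%:R / (1 + x)))).
  by rewrite expr1; ring.
rewrite ler_wpM2l// -[k.*2.+1%:R / _]invf_div; apply: powR_ge_linear => //.
by rewrite ler1n.
Unshelve. all: by end_near. Qed.

End PoissonSums.

(** * Bessel function and heat kernel *)

Section Bessel.
Context {R : realType}.
Variable zeta : R.
Hypothesis hzeta : - 2^-1 < zeta.
Implicit Types x t r s : R.

(* Ratio between the coefficient of [(x/2)^(2k + zeta - 1/2)] in [I_(zeta - 1/2)], times
   [4^-k], and [(2k+1)^(-zeta) / (2k)!]. *)
Let coef (k : nat) : R := (k.*2)`!%:R * k.*2.+1%:R `^ zeta /
  (4 ^+ k * (k`!%:R * Gamma (k%:R + (zeta - 2^-1) + 1))).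

Let arg_gt0 k : 0 < k%:R + (zeta - 2^-1) + 1.
Proof. by have := ler0n R k; have := hzeta; lra. Qed.

Let coef_gt0 k : 0 < coef k.
Proof.
rewrite divr_gt0 ?mulr_gt0 ?powR_gt0 ?exprn_gt0 ?Gamma_gt0 ?ltr0n ?fact_gt0 ?arg_gt0//.
Qed.

(** By the functional equation of [Gamma], the quotient of consecutive coefficients is
    [(1 + u)^zeta / (1 + zeta u)]. Its first-order terms in [u] cancel, which is what the weights
    [(2k+1)^(-zeta)] were chosen for. *)
Let coefS k : let u : R := 2 / k.*2.+1%:R in
  coef k.+1 = coef k * ((1 + u) `^ zeta / (1 + zeta * u)).
Proof.
move=> u; rewrite /coef.
have -> : k.+1%:R + (zeta - 2^-1) + 1 = (k%:R + (zeta - 2^-1) + 1) + 1 :> R.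
  by rewrite -natr1; ring.
rewrite (GammaD1 (arg_gt0 k)) doubleS !factS !natrM exprS.
have k0 : 0 < k.*2.+1%:R :> R by [].
have -> : k.*2.+3%:R = k.*2.+1%:R * (1 + u) :> R.
  rewrite /u mulrDr mulr1 mulrCA divff ?gt_eqF// mulr1.
  by rewrite -[k.*2.+3]addn2 natrD.
have u0 : 0 < u by rewrite divr_gt0.
rewrite powRM//; last by rewrite addr_ge0 ?ltW.
have G0 := Gamma_gt0 (arg_gt0 k); have A0 := arg_gt0 k.
move: (Gamma _) G0 (_ `^ zeta) (_ `^ zeta) => G G0 P Q.
have X0 : 0 < 4 ^+ k :> R by rewrite exprn_gt0.
have f0 : 0 < k`!%:R :> R by rewrite ltr0n fact_gt0.
move: (4 ^+ k) X0 k`!%:R f0 (k.*2)`!%:R => X X0 f f0 F.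
rewrite /u -[k.*2.+2]addn2 -[k.*2.+1]addn1 -[k.+1]addn1 !natrD -muln2 natrM.
move: A0; have := ler0n R k; move: (k%:R : R) => y y0 A0.
field.
by rewrite !gt_eqF//; lra.
Qed.

Lemma bessel_coef_bounded :
  exists2 K : R, 0 < K & forall k, coef k <= K /\ 1 <= K * coef k.
Proof.
apply: (@bounded_of_ratio R coef (2 * (`|zeta| + zeta ^+ 2)) coef_gt0) => k.
rewrite coefS; set u := 2 / _.
have Y0 : 0 < k.+1.*2.+1%:R :> R by [].
have Y3 : 3 <= k.+1.*2.+1%:R :> R by rewrite ler_nat doubleS.
have u0 : 0 < u by rewrite divr_gt0.
have u23 : u <= 2 / 3 by rewrite ler_pdivrMr//; lra.
have w0 : - 2^-1 <= zeta * u.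
  have : 0 <= (zeta + 2^-1) * u by rewrite mulr_ge0 ?(ltW u0)//; move: hzeta; lra.
  by rewrite mulrDl; lra.
rewrite lnM ?posrE//; last by rewrite divr_gt0 ?powR_gt0//; lra.
rewrite addrC addKr ln_div ?posrE ?powR_gt0//; [|lra..].
rewrite ln_powR.
have -> : zeta * ln (1 + u) - ln (1 + zeta * u) =
  zeta * (ln (1 + u) - u) - (ln (1 + zeta * u) - zeta * u) by ring.
apply: (le_trans (ler_normB _ _)); rewrite normrM.
have h1 : `|ln (1 + u) - u| <= 2 * u ^+ 2 by apply: ln1D_dist; lra.
have h2 := ln1D_dist w0.
apply: (@le_trans _ _ (2 * (`|zeta| + zeta ^+ 2) * u ^+ 2)).
  apply: (le_trans (lerD (ler_wpM2l (normr_ge0 zeta) h1) h2)).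
  suff -> : `|zeta| * (2 * u ^+ 2) + 2 * (zeta * u) ^+ 2 =
    2 * (`|zeta| + zeta ^+ 2) * u ^+ 2 by [].
  by ring.
have Z0 : 0 <= 2 * (`|zeta| + zeta ^+ 2) by rewrite mulr_ge0// addr_ge0// sqr_ge0.
rewrite ler_wpM2l// /u.
rewrite -[k.+1.*2.+1]addn1 -[k.+2]addn1 -[k.+1]addn1 -muln2 !natrD natrM natrD.
have := ler0n R k; move: (k%:R : R) => y y0.
(* Here [u = 2 / (2k + 3)], and [(2k + 3)^2 = 4 (k + 1) (k + 2) + 1], so [u^2] lies below the
   telescoping difference. *)
have -> : (y + 1)^-1 - (y + 1 + 1)^-1 = ((y + 1) * (y + 1 + 1))^-1.
  by field; rewrite !gt_eqF//; lra.
rewrite expr_div_n ler_pdivrMr; last by rewrite exprn_gt0; lra.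
by rewrite mulrC ler_pdivlMr ?mulr_gt0//; nra.
Qed.

Let bterm x (k : nat) : R := ((x / 2) `^ (2 * k%:R + (zeta - 2^-1))) /
  ((k`!)%:R * Gamma (k%:R + (zeta - 2^-1) + 1)).

Let pref x := (x / 2) `^ (zeta - 2^-1) * (1 + x) `^ (- zeta).

Let pref_gt0 x : 0 < x -> 0 < pref x.
Proof. by move=> x0; rewrite mulr_gt0 ?powR_gt0 ?divr_gt0//; lra. Qed.

(** The power [(1 + x)^zeta] is inserted in the sum and removed again by [pref]; the remaining
    weights [((1 + x) / (2k+1))^zeta] are of order 1 where the Poisson law concentrates. *)
Let btermE x k : 0 < x -> bterm x k = pref x * (coef k *
  (exp_coeff x k.*2 * ((1 + x) / k.*2.+1%:R) `^ zeta)).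
Proof.
move=> x0; have x1 : 0 < 1 + x by lra.
have x20 : 0 < x / 2 by rewrite divr_gt0.
rewrite /bterm powRD ?(gt_eqF x20) ?implybT// -natrM powR_mulrn ?(ltW x20)//.
rewrite /pref powRN /coef /exp_coeff/= [((1 + x) / _) `^ zeta]powRM ?invr_ge0 ?(ltW x1)//.
rewrite -[k.*2.+1%:R^-1]powR_inv1// -powRrM mulN1r powRN.
rewrite mul2n expr_div_n -[in 2 ^+ _]mul2n exprM.
have -> : 2 ^+ 2 = 4 :> R by rewrite expr2; ring.
have G0 := Gamma_gt0 (arg_gt0 k).
have A0 : 0 < (1 + x) `^ zeta by rewrite powR_gt0.
have B0 : 0 < k.*2.+1%:R `^ zeta :> R by rewrite powR_gt0.
have X0 : 0 < 4 ^+ k :> R by rewrite exprn_gt0.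
have f0 : 0 < k`!%:R :> R by rewrite ltr0n fact_gt0.
have F0 : 0 < (k.*2)`!%:R :> R by rewrite ltr0n fact_gt0.
move: (Gamma _) G0 ((1 + x) `^ _) A0 (k.*2.+1%:R `^ _) B0 (4 ^+ k) X0 k`!%:R f0 (k.*2)`!%:R F0.
move=> G G0 A A0 B B0 X X0 f f0 F F0; move: (x ^+ _) (_ `^ _) => y z.
by field; rewrite !gt_eqF.
Qed.

Let bterm_ge0 x k : 0 < x -> 0 <= bterm x k.
Proof.
move=> x0; rewrite divr_ge0 ?powR_ge0// mulr_ge0// ltW// Gamma_gt0// arg_gt0.
Qed.

Let series_bterm_le : exists2 K : R, 0 < K & forall x N, 0 < x ->
  series (bterm x) N <= K * (pref x * expR x).
Proof.
have z1 : -1 <= zeta by move: hzeta; lra.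
have [K1 K10 h1] := bessel_coef_bounded.
have [K2 K20 h2] := sum_weighted_le z1.
exists (K1 * K2) => [|x N x0]; first by rewrite mulr_gt0.
have -> : K1 * K2 * (pref x * expR x) = pref x * (K1 * (K2 * expR x)) by ring.
rewrite /series/=; under eq_bigr do rewrite btermE//.
rewrite -mulr_sumr ler_wpM2l ?(ltW (pref_gt0 x0))//.
apply: (@le_trans _ _ (K1 * \sum_(0 <= k < N) (exp_coeff x k.*2 * ((1 + x) / k.*2.+1%:R) `^ zeta))).
  rewrite mulr_sumr ler_sum// => k _; rewrite ler_wpM2r//; last by have [] := h1 k.
  by rewrite mulr_ge0 ?powR_ge0// exp_coeff_ge0 ?ltW.
rewrite ler_wpM2l ?(ltW K10)//; apply: le_trans (h2 x N.*2 (ltW x0)).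
apply: (@sum_even_le _ (fun n => exp_coeff x n * ((1 + x) / n.+1%:R) `^ zeta)) => n.
by rewrite mulr_ge0 ?powR_ge0// exp_coeff_ge0 ?ltW.
Qed.

Let series_bterm_nd x : 0 < x -> nondecreasing_seq (series (bterm x)).
Proof.
by move=> x0; apply/nondecreasing_seqP => n; rewrite seriesSr lerDl bterm_ge0.
Qed.

(** [besselI] is a [limn], so the bounds on partial sums pass to it only once convergence is
    known. *)
Lemma is_cvg_besselI x : 0 < x -> cvgn (series (bterm x)).
Proof.
move=> x0; have [K K0 hK] := series_bterm_le.
apply: nondecreasing_is_cvgn; first exact: series_bterm_nd.
by exists (K * (pref x * expR x)) => _ [N _ <-]; exact: hK.
Qed.

Lemma besselI_bounds : exists2 K : R, 0 < K & forall x, 0 < x ->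
  besselI (zeta - 2^-1) x <= K * (pref x * expR x) /\
  pref x * expR x <= K * besselI (zeta - 2^-1) x.
Proof.
have [K1 K10 h1] := series_bterm_le.
have [K2 K20 h2] := bessel_coef_bounded.
have [c c0 h3] := sum_weighted_ge zeta.
exists (K1 + K2 / c) => [|x x0]; first by rewrite addr_gt0// divr_gt0.
have P0 : 0 < pref x * expR x by rewrite mulr_gt0 ?expR_gt0 ?pref_gt0.
have bE : besselI (zeta - 2^-1) x = limn (series (bterm x)) by [].
have cv := is_cvg_besselI x0.
have up : besselI (zeta - 2^-1) x <= K1 * (pref x * expR x).
  by rewrite bE; apply: limr_le => //; apply: nearW => N; exact: h1.
have lo : pref x * expR x <= K2 / c * besselI (zeta - 2^-1) x.
  rewrite [leRHS]mulrAC ler_pdivlMr// -ler_pdivrMl// bE.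
  apply: limr_ge => //; near=> N.
  have hN : c * expR x <= \sum_(0 <= k < N) (exp_coeff x k.*2 * ((1 + x) / k.*2.+1%:R) `^ zeta).
    by near: N; exact/h3/ltW.
  rewrite ler_pdivrMl// /series/=; under eq_bigr do rewrite btermE//.
  rewrite -mulr_sumr mulrCA -mulrA ler_wpM2l ?(ltW (pref_gt0 x0))// mulrC.
  apply: (le_trans hN); rewrite mulr_sumr ler_sum// => k _.
  have [_ hk] := h2 k; rewrite [leRHS]mulrA ler_peMl//.
  by rewrite mulr_ge0 ?powR_ge0// exp_coeff_ge0 ?ltW.
have b0 : 0 <= besselI (zeta - 2^-1) x.
  by move: lo; rewrite -ler_pdivrMl ?divr_gt0//; apply: le_trans; rewrite mulr_ge0 ?invr_ge0 ?ltW ?divr_gt0.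
split; first by rewrite mulrDl (le_trans up)// lerDl mulr_ge0 ?ltW ?divr_gt0.
by rewrite mulrDl (le_trans lo)// lerDr mulr_ge0// ltW.
Unshelve. all: by end_near. Qed.

(** At [x = r s / (2 t)] one has [1 + x = (2 t + r s) / (2 t)], and the powers of [r s] cancel. What
    remains is [Phi] with [2 t] in place of [t] inside the sum, a discrepancy worth a factor
    [2^|zeta|]. *)
Let pref_p2 t r s : 0 < t -> 0 < r -> 0 < s ->
  (r * s) `^ (2^-1 - zeta) / (2 * t) * pref (r * s / (2 * t)) =
  2 `^ (- 1) * 4 `^ (2^-1 - zeta) * 2 `^ zeta * (t `^ (- 2^-1) * (2 * t + r * s) `^ (- zeta)).
Proof.
move=> t0 r0 s0; have rs0 : 0 < r * s by rewrite mulr_gt0.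
have T0 : 0 < 2 * t + r * s by rewrite addr_gt0// mulr_gt0.
have t20 : 0 < 2 * t by rewrite mulr_gt0.
rewrite /pref.
have -> : r * s / (2 * t) / 2 = (r * s) / (4 * t) by field; rewrite gt_eqF.
have -> : 1 + r * s / (2 * t) = (2 * t + r * s) / (2 * t) by field; rewrite gt_eqF.
have E4 : 4 = 2 * 2 :> R by ring.
have t40 : 0 < 4 * t by rewrite mulr_gt0.
have inv a : 0 < a -> a^-1 = expR (- ln a) :> R by move=> a0; rewrite expRN lnK.
(* Every factor becomes the exponential of a multiple of a logarithm, so that the identity reduces
   to a linear one between [ln] terms. *)
rewrite /powR !gt_eqF ?divr_gt0// !ln_div ?posrE// (inv (2 * t))//.
by rewrite E4 !lnM ?posrE// -!expRD; congr expR; field.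
Qed.

Lemma p2_bounds : exists2 K : R, 0 < K & forall t r s, 0 < t -> 0 < r -> 0 < s ->
  p2 zeta t r s <= K * (Phi zeta t (r * s) * expR (- ((r - s) ^+ 2 / (4 * t)))) /\
  Phi zeta t (r * s) * expR (- ((r - s) ^+ 2 / (4 * t))) <= K * p2 zeta t r s.
Proof.
have [K K0 hK] := besselI_bounds.
pose A : R := 2 `^ (- 1) * 4 `^ (2^-1 - zeta) * 2 `^ zeta.
have A0 : 0 < A by rewrite !mulr_gt0 ?powR_gt0.
pose L : R := 2 `^ `|zeta|; have L0 : 0 < L by rewrite powR_gt0.
exists (K * A * L + K * L / A) => [|t r s t0 r0 s0].
  by rewrite addr_gt0 ?mulr_gt0 ?invr_gt0.
have rs0 : 0 < r * s by rewrite mulr_gt0.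
pose x := r * s / (2 * t); have x0 : 0 < x by rewrite divr_gt0// mulr_gt0.
pose pr := (r * s) `^ (2^-1 - zeta) / (2 * t) * expR (- (r ^+ 2 + s ^+ 2) / (4 * t)).
have pr0 : 0 < pr by rewrite !mulr_gt0 ?powR_gt0 ?expR_gt0// invr_gt0 mulr_gt0.
pose G := t `^ (- 2^-1) * (2 * t + r * s) `^ (- zeta) * expR (- ((r - s) ^+ 2 / (4 * t))).
have prE : pr * (pref x * expR x) = A * G.
  (* The factor [e^x] from the Bessel function completes the square: [-(r^2 + s^2) / (4 t) + r s /
     (2 t) = -(r - s)^2 / (4 t)]. *)
  have -> : pr * (pref x * expR x) = (r * s) `^ (2^-1 - zeta) / (2 * t) * pref x *
     (expR (- (r ^+ 2 + s ^+ 2) / (4 * t)) * expR x) by rewrite /pr; ring.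
  rewrite pref_p2// -expRD /G /A [in RHS]mulrA; congr (_ * expR _).
  by rewrite /x; field; rewrite gt_eqF.
have Ph := @Phi_gt0 R zeta t (r * s) t0 (ltW rs0).
set H := Phi zeta t (r * s) * _.
have H0 : 0 <= H by rewrite mulr_ge0 ?expR_ge0 ?ltW.
have GH : G <= L * H.
  rewrite /G /H /Phi [leRHS]mulrA ler_wpM2r ?expR_ge0// mulrCA ler_wpM2l ?powR_ge0//.
  by rewrite /L -(normrN zeta); apply: powR_le_scale; nra.
have HG : H <= L * G.
  rewrite /G /H /Phi [leRHS]mulrA ler_wpM2r ?expR_ge0// mulrCA ler_wpM2l ?powR_ge0//.
  by rewrite /L -(normrN zeta); apply: powR_le_scale; nra.
have [b1 b2] := hK x x0.
have p2E : p2 zeta t r s = pr * besselI (zeta - 2^-1) x by [].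
have u1 : p2 zeta t r s <= K * A * L * H.
  rewrite p2E; apply: (le_trans (ler_wpM2l (ltW pr0) b1)).
  by rewrite mulrCA prE -!mulrA !ler_pM2l.
have u2 : H <= K * L / A * p2 zeta t r s.
  apply: (le_trans HG); have := ler_wpM2l (ltW pr0) b2; rewrite prE [pr * (K * _)]mulrCA -p2E => h.
  have -> : K * L / A * p2 zeta t r s = L * (K * p2 zeta t r s / A) by ring.
  by rewrite ler_pM2l// ler_pdivlMr// mulrC.
have p0 : 0 <= p2 zeta t r s.
  have KLA : 0 < K * L / A by rewrite divr_gt0// mulr_gt0.
  by rewrite -(pmulr_rge0 _ KLA) (le_trans H0).
split; first by rewrite mulrDl (le_trans u1)// lerDl mulr_ge0// !mulr_ge0 ?invr_ge0 ?ltW.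
by rewrite mulrDl (le_trans u2)// lerDr mulr_ge0// !mulr_ge0 ?ltW.
Qed.

Lemma measurable_p2 r s : 0 < r -> 0 < s ->
  measurable_fun (`]0%R, +oo[%classic : set R) (fun t => p2 zeta t r s).
Proof.
move=> r0 s0.
have minv c : measurable_fun (`]0%R, +oo[%classic : set R) (fun t : R => (c * t)^-1).
  apply: (@eq_measurable_fun _ _ _ _ _ (fun t : R => c^-1 * t `^ (- 1))).
    by move=> t; rewrite inE/= in_itv/= andbT => t0; rewrite powR_inv1 ?(ltW t0)// invfM.
  by apply: measurable_funM => //; apply: measurable_funTS; exact: measurable_powR.
have mx : measurable_fun (`]0%R, +oo[%classic : set R) (fun t : R => r * s / (2 * t)).
  by apply: measurable_funM.
apply: measurable_funM; first (apply: measurable_funM; first by apply: measurable_funM).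
  by apply: measurableT_comp => //; apply: measurable_funM.
apply: (@measurable_fun_cvg _ _ _ _ (fun N t => series (bterm (r * s / (2 * t))) N)).
  move=> N; rewrite /series/=; apply: measurable_sum => k.
  apply: measurable_funM => //.
  apply: (@measurableT_comp _ _ _ _ _ _ (fun y : R => y `^ (2 * k%:R + (zeta - 2^-1)))).
    exact: measurable_powR.
  by apply: measurable_funM.
by move=> t /=; rewrite in_itv/= andbT => t0; apply: is_cvg_besselI; rewrite divr_gt0 ?mulr_gt0.
Qed.

End Bessel.

(** * Integrals against the stable density *)

Section Subordinator.
Context {R : realType}.
Local Notation mu := (@lebesgue_measure R).
Local Notation D0 := (`]0%R, +oo[%classic : set R).
Implicit Types t T tau x A : R.

Lemma expRN_le_half (y : R) : 0 <= y <= 1 -> expR (- y) <= 1 - y / 2.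
Proof.
move=> /andP[y0 y1]; rewrite expRN -div1r ler_pdivrMr ?expR_gt0//.
by have := expR_ge1Dx y; nra.
Qed.

Lemma dyadic_ex (y : R) : 1 <= y -> exists n : nat, 2 ^+ n <= y < 2 ^+ n.+1.
Proof.
move=> y1; have ex : exists n, y < 2 ^+ n.
  exists (Num.bound y); have y0 : 0 <= y by lra.
  apply: (lt_trans (archi_boundP y0)).
  by rewrite -natrX ltr_nat ltn_expl.
case: (ex_minnP ex) => [[|n]]; first by rewrite expr0 ltNge y1.
move=> yn hn; exists n; rewrite yn andbT leNgt; apply/negP => /hn.
by rewrite ltnn.
Qed.

Variables (beta : R) (sigma : R -> R -> R).
Hypothesis hbeta : 0 < beta < 1.
Hypothesis hsigma : subordinator_density beta sigma.

(** The expectation of [f] at the subordinator at time [t]. It stays in the extended reals so that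
    finiteness is a conclusion rather than an assumption. *)
Let J t (f : R -> R) : \bar R := (\int[mu]_(tau in D0) (f tau * sigma t tau)%:E)%E.

Let sigma_ge0 t tau : 0 < t -> D0 tau -> 0 <= sigma t tau.
Proof.
by move=> t0; rewrite /= in_itv/= andbT => tau0; have [_ h _ _] := hsigma t0; exact: h.
Qed.

Let measurable_J t (f : R -> R) : 0 < t -> measurable_fun D0 f ->
  measurable_fun D0 (fun tau => (f tau * sigma t tau)%:E).
Proof.
move=> t0 mf; have [ms _ _ _] := hsigma t0.
by apply/measurable_EFinP; exact: measurable_funM.
Qed.

Lemma laplace_ge0 t (f : R -> R) : 0 < t -> (forall tau, 0 < tau -> 0 <= f tau) ->
  (0 <= J t f)%E.
Proof.
move=> t0 f0; apply: integral_ge0 => tau tau0; rewrite lee_fin mulr_ge0 ?sigma_ge0//.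
by move: tau0; rewrite /= in_itv/= andbT => tau0; exact: f0.
Qed.

Lemma laplace_le t (f g : R -> R) : 0 < t ->
  measurable_fun D0 f -> measurable_fun D0 g ->
  (forall tau, 0 < tau -> 0 <= f tau) -> (forall tau, 0 < tau -> f tau <= g tau) ->
  (J t f <= J t g)%E.
Proof.
move=> t0 mf mg f0 fg; apply: ge0_le_integral => //.
- move=> tau tau0; rewrite lee_fin mulr_ge0 ?sigma_ge0//.
  by move: tau0; rewrite /= in_itv/= andbT => tau0; exact: f0.
- exact: measurable_J.
- exact: measurable_J.
- move=> tau tau0; rewrite lee_fin ler_wpM2r ?sigma_ge0//.
  by move: tau0; rewrite /= in_itv/= andbT => tau0; exact: fg.
Qed.

Lemma laplaceD t (f g : R -> R) : 0 < t ->
  measurable_fun D0 f -> measurable_fun D0 g ->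
  (forall tau, 0 < tau -> 0 <= f tau) -> (forall tau, 0 < tau -> 0 <= g tau) ->
  J t (fun tau => f tau + g tau) = (J t f + J t g)%E.
Proof.
move=> t0 mf mg f0 g0; rewrite /J -ge0_integralD//.
- by apply: eq_integral => tau _; rewrite mulrDl EFinD.
- move=> tau tau0; rewrite lee_fin mulr_ge0 ?sigma_ge0//.
  by move: tau0; rewrite /= in_itv/= andbT => tau0; exact: f0.
- exact: measurable_J.
- move=> tau tau0; rewrite lee_fin mulr_ge0 ?sigma_ge0//.
  by move: tau0; rewrite /= in_itv/= andbT => tau0; exact: g0.
- exact: measurable_J.
Qed.

Lemma measurable_expRZ (a lambda : R) :
  measurable_fun D0 (fun tau => a * expR (- (tau * lambda))).
Proof.
apply: measurable_funTS; apply: measurable_funM => //; apply: measurableT_comp => //.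
by apply: measurable_funN; exact: measurable_funM.
Qed.

Lemma laplace_exp t (a lambda : R) : 0 < t -> 0 <= a -> 0 <= lambda ->
  J t (fun tau => a * expR (- (tau * lambda))) = (a * expR (- (t * lambda `^ beta)))%:E.
Proof.
move=> t0 a0 l0; have [_ _ _ h] := hsigma t0.
rewrite EFinM -h// -ge0_integralZl_EFin//.
- by apply: eq_integral => tau _; rewrite -mulrA EFinM.
- by move=> tau tau0; rewrite lee_fin mulr_ge0 ?expR_ge0 ?sigma_ge0.
- apply: measurable_J => //.
  apply: (@eq_measurable_fun _ _ _ _ _ (fun tau => 1 * expR (- (tau * lambda)))).
    by move=> tau _; rewrite mul1r.
  exact: measurable_expRZ.
Qed.

Lemma laplace_cst t a : 0 < t -> 0 <= a -> J t (fun=> a) = a%:E.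
Proof.
move=> t0 a0; have := laplace_exp t0 a0 (lexx 0).
rewrite powR0 ?gt_eqF//; last by case/andP: hbeta.
by rewrite mulr0 oppr0 expR0 mulr1 => <-; congr (J t _); apply/funext => tau;
  rewrite mulr0 oppr0 expR0 mulr1.
Qed.

(* Moving the exponential to the left keeps all integrands nonnegative. *)
Lemma laplace_upper_tail t T A (f : R -> R) : 0 < t -> 0 < T -> 0 <= A ->
  measurable_fun D0 f -> (forall tau, 0 < tau -> 0 <= f tau) ->
  (forall tau, 0 < tau -> f tau <= A * (1 - expR (- (tau / T)))) ->
  (J t f <= (A * (t * T^-1 `^ beta))%:E)%E.
Proof.
move=> t0 T0 A0 mf f0 fA.
have TV0 : 0 <= T^-1 by rewrite invr_ge0 ltW.
have : (J t (fun tau => (f tau + A * expR (- (tau / T)))%R) <= J t (fun=> A))%E.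
  apply: laplace_le => //.
  - by apply: measurable_funD => //; exact: measurable_expRZ.
  - by move=> tau tau0; rewrite addr_ge0 ?f0// mulr_ge0 ?expR_ge0.
  - by move=> tau tau0; have := fA _ tau0; rewrite mulrBr mulr1; lra.
rewrite laplaceD//; last 2 first.
- exact: measurable_expRZ.
- by move=> tau tau0; rewrite mulr_ge0 ?expR_ge0.
rewrite laplace_exp// laplace_cst//.
case: (J t f) => [v|h|_]; [|by rewrite addye// leye_eq in h|by rewrite leNye].
rewrite -EFinD !lee_fin => h.
have := expR_ge1Dx (- (t * T^-1 `^ beta)); nra.
Qed.

(* With [x = tau / T] and [q = B^(-(1 + beta)/2)], the combination
   [e^-x - e^(-2x) - q (1 - e^(-Bx))] is nonpositive for [x <= 1/B], hence at most
   [f / A]; its integral is of order [t T^-beta] because [q B^beta] is small. *)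
Lemma laplace_lower : exists2 B : R, 0 < B & exists2 c : R, 0 < c &
  forall t T A (f : R -> R), 0 < t -> 0 < T -> 0 <= A -> t * T^-1 `^ beta <= 1 ->
    measurable_fun D0 f -> (forall tau, 0 < tau -> 0 <= f tau) ->
    (forall tau, 0 < tau -> T <= B * tau -> A * expR (- (tau / T)) <= f tau) ->
    ((c * (A * (t * T^-1 `^ beta)))%:E <= J t f)%E.
Proof.
have /andP[b0 b1] := hbeta.
have p2 : 1 < 2 `^ beta :> R.
  by rewrite -[ltLHS](powRr0 (2:R)) /powR pnatr_eq0/= mul0r ltr_expR mulr_gt0// ln_gt0// ltr1n.
have p2' : 2 `^ beta <= 2 :> R.
  by rewrite -[leRHS]powRr1// ler_powR ?ler1n// ltW.
(* For [u <= 1], [e^(-u) - e^(-2^beta u)] is at least [c0 u]: factor out [e^(-u) >= e^(-1)] and use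
   [1 - e^(-y) >= y / 2] at [y = (2^beta - 1) u <= 1]. *)
pose c0 : R := expR (- 1) * (2 `^ beta - 1) / 2.
have c00 : 0 < c0 by rewrite divr_gt0// mulr_gt0 ?expR_gt0// subr_gt0.
(* [M >= 2] gives the pointwise inequality for small [tau]; [M >= 2 / c0] makes the subtracted term
   cost at most half of the gain [c0 u]. The exponent [g] below is chosen so that [q B = M] and
   [q B^beta = 1 / M] hold together. *)
pose M : R := 2 + 2 / c0; have M0 : 0 < M by rewrite addr_gt0// divr_gt0.
pose g : R := (1 - beta) / 2; have g0 : 0 < g by rewrite divr_gt0// subr_gt0.
pose B := M `^ g^-1; have B0 : 0 < B by rewrite powR_gt0.
have BM : B `^ g = M by rewrite /B -powRrM mulVf ?gt_eqF// powRr1// ltW.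
pose q := B `^ (- ((1 + beta) / 2)); have q0 : 0 < q by rewrite powR_gt0.
have qB : q * B = M.
  rewrite -[B in LHS]powRr1 ?(ltW B0)// /q -powRD ?(gt_eqF B0) ?implybT// -BM.
  by congr powR; rewrite /g; field.
have qBb : q * B `^ beta = M^-1.
  rewrite /q -powRD ?(gt_eqF B0) ?implybT// -BM -powRN.
  by congr powR; rewrite /g; field.
exists B => //; exists (c0 / 2) => [|t T A f t0 T0 A0 u1 mf f0 fA]; first by rewrite divr_gt0.
have TV0 : 0 <= T^-1 by rewrite invr_ge0 ltW.
set u := t * _ in u1 *; have u0 : 0 <= u by rewrite mulr_ge0 ?powR_ge0// ltW.
have g1 : 1 - B `^ beta * u <= expR (- (B `^ beta * u)) by exact: expR_ge1Dx.
have g2 : c0 * u <= expR (- u) - expR (- (2 `^ beta * u)).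
  have -> : - (2 `^ beta * u) = - u + - ((2 `^ beta - 1) * u) by ring.
  rewrite expRD.
  have e1 : expR (- 1) <= expR (- u) by rewrite ler_expR lerN2.
  have y0 : 0 <= (2 `^ beta - 1) * u by rewrite mulr_ge0// subr_ge0 ltW.
  have : expR (- ((2 `^ beta - 1) * u)) <= 1 - (2 `^ beta - 1) * u / 2.
    by apply: expRN_le_half; rewrite y0/=; nra.
  have e0 : 0 < expR (- 1) :> R by exact: expR_gt0.
  have -> : c0 * u = expR (- 1) * ((2 `^ beta - 1) * u / 2) by rewrite /c0; ring.
  move: e0 e1 y0; move: ((2 `^ beta - 1) * u) => y.
  move: (expR (- y)) (expR (- u)) (expR (- 1)) => E1 E2 E3 E30 E32 y0 E1y.
  by rewrite -[X in X - _]mulr1 -mulrBr; apply: ler_pM; lra.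
have g3 : q * (1 - expR (- (B `^ beta * u))) <= c0 / 2 * u.
  apply: (@le_trans _ _ (q * B `^ beta * u)).
    by rewrite -mulrA ler_wpM2l ?(ltW q0)// lerBlDr -lerBlDl.
  rewrite qBb ler_wpM2r// -div1r ler_pdivrMr// /M mulrDr.
  have -> : c0 / 2 * (2 / c0) = 1 by field; rewrite gt_eqF.
  by nra.
have : (J t (fun tau => (A * expR (- (tau * T^-1)) + A * q * expR (- (tau * (B * T^-1))))%R) <=
        J t (fun tau => (A * expR (- (tau * (2 * T^-1))) + (A * q + f tau))%R))%E.
  apply: laplace_le => //.
  - by apply: measurable_funD; exact: measurable_expRZ.
  - by apply: measurable_funD; [exact: measurable_expRZ|exact: measurable_funD].
  - by move=> tau _; rewrite addr_ge0 ?mulr_ge0 ?expR_ge0// ltW.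
  clear g1 g2 g3 => tau tau0; have x0 : 0 < tau / T by rewrite divr_gt0.
  have Aq : 0 <= A * q by rewrite mulr_ge0// ltW.
  (* If [T <= B tau], the hypothesis on [f] covers the main exponential. Otherwise only [f >= 0] is
     known, and the [q] terms dominate the difference of the two exponentials. *)
  have [TB|TB] := leP T (B * tau).
    have := fA tau tau0 TB; have := expR_ge0 (- (tau * (2 / T))).
    have : expR (- (tau * (B / T))) <= 1.
      by rewrite -[leRHS]expR0 ler_expR oppr_le0 mulr_ge0 ?divr_ge0 ?ltW.
    move: (expR _) (expR _) (expR _) => e1 e2 e3 h1 h2 h3.
    have : A * q * e3 <= A * q by rewrite ler_piMr.
    have : 0 <= A * e2 by rewrite mulr_ge0.
    by lra.
  have Bx : B * (tau / T) <= 1 by rewrite mulrA ler_pdivrMr// mul1r ltW.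
  have Bx0 : 0 <= B * (tau / T) by rewrite mulr_ge0 ?ltW.
  have h1 : expR (- (B * (tau / T))) <= 1 - B * (tau / T) / 2.
    by apply: expRN_le_half; rewrite Bx0.
  rewrite [tau * (B / T)]mulrCA.
  have h2 : expR (- (tau / T)) - expR (- (tau * (2 / T))) <= tau / T.
    have -> : - (tau * (2 / T)) = - (tau / T) + - (tau / T) by ring.
    rewrite expRD; have := expR_ge1Dx (- (tau / T)); have := expR_gt0 (- (tau / T)).
    have : expR (- (tau / T)) <= 1 by rewrite -[leRHS]expR0 ler_expR oppr_le0 ltW.
    by move: (expR _) => e; nra.
  have M2 : 2 <= M by rewrite lerDl divr_ge0// ltW.
  have h3 : tau / T <= q * (1 - expR (- (B * (tau / T)))).
    apply: (@le_trans _ _ (q * (B * (tau / T) / 2))); last by rewrite ler_wpM2l ?(ltW q0)//; lra.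
    by rewrite !mulrA qB -!mulrA; nra.
  have f00 := f0 _ tau0.
  have := ler_wpM2l A0 (le_trans h2 h3); lra.
rewrite !laplaceD//; try exact: measurable_expRZ; try exact: measurable_funD;
  try (by move=> tau _; rewrite ?mulr_ge0 ?expR_ge0// ltW);
  try (by move=> tau tau0; rewrite addr_ge0 ?f0// mulr_ge0// ltW).
rewrite !laplace_exp ?mulr_ge0 ?(ltW q0) ?(ltW B0)// laplace_cst ?mulr_ge0 ?(ltW q0)//.
rewrite (powRM _ (ltW B0))// (powRM beta (ler0n _ 2))// [t * (B `^ _ * _)]mulrCA [t * (2 `^ _ * _)]mulrCA -/u.
case: (J t f) => [v|_|]//; last by rewrite leey.
rewrite -!EFinD !lee_fin => h.
have := ler_wpM2l A0 g3; have := ler_wpM2l A0 g2; move: h; clear.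
by move: (expR (- u)) (expR (- (2 `^ beta * u))) (expR (- (B `^ beta * u))) => *; lra.
Qed.

(* Negative moments: if [2^n <= T / tau < 2^(n+1)] then [(1 + T / tau)^m] is at most
   [2^((n+2)m) e^(1 - 2^n tau / T)], whose integral is summable in [n]. *)
Lemma laplace_upper_bulk (m : R) : 0 <= m -> exists2 K : R, 0 < K &
  forall t T A (f : R -> R), 0 < t -> 0 < T -> 0 <= A -> t * T^-1 `^ beta = 1 ->
    measurable_fun D0 f -> (forall tau, 0 < tau -> 0 <= f tau) ->
    (forall tau, 0 < tau -> f tau <= A * (1 + T / tau) `^ m) ->
    (J t f <= (A * K)%:E)%E.
Proof.
move=> m0; have /andP[b0 b1] := hbeta.
have [K1 K10 hK] := @powR_le_expR R ((m + 1) / beta) 1 ltr01.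
pose a (n : nat) : R := expR 1 * (2 ^+ n.+2) `^ m.
have a0 n : 0 <= a n by rewrite mulr_ge0 ?expR_ge0 ?powR_ge0.
pose K2 : R := expR 1 * 4 `^ m * 2 * K1.
have K20 : 0 < K2 by rewrite !mulr_gt0 ?expR_gt0 ?powR_gt0.
(* One power more than [m] is extracted from the stretched exponential; the spare factor [2^(-n)]
   makes the dyadic series geometric. *)
have aK n : a n * expR (- (2 ^+ n) `^ beta) <= K2 / (2 ^ n.+1)%:R.
  pose Y : R := 2 ^+ n; have Y0 : 0 < Y by rewrite exprn_gt0.
  have YK : Y `^ (m + 1) <= K1 * expR (Y `^ beta).
    have := hK (Y `^ beta) (powR_ge0 _ _); rewrite mul1r; apply: le_trans.
    rewrite -[X in Y `^ X](@divfK _ beta) ?gt_eqF// mulrC [Y `^ _]powRrM.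
    apply: ge0_ler_powR; rewrite ?nnegrE ?addr_ge0 ?powR_ge0//.
      by rewrite divr_ge0 ?(ltW b0)// addr_ge0.
    by rewrite lerDr.
  rewrite ler_pdivlMr ?ltr0n ?expn_gt0//.
  rewrite natrX exprS -/Y /a !exprS mulrA -[2 * 2 * _]/(2 * 2 * Y).
  rewrite powRM ?(ltW Y0)// -natrM.
  have -> : expR 1 * ((2 * 2)%:R `^ m * Y `^ m) * expR (- Y `^ beta) * (2 * Y) =
     expR 1 * 4 `^ m * 2 * (Y `^ m * Y * expR (- Y `^ beta)) by ring.
  rewrite /K2 ler_wpM2l ?mulr_ge0 ?expR_ge0 ?powR_ge0//.
  have -> : Y `^ m * Y = Y `^ (m + 1) by rewrite powRD ?(gt_eqF Y0) ?implybT// powRr1 ?ltW.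
  by rewrite expRN ler_pdivrMr ?expR_gt0.
exists (2 `^ m + K2) => [|t T A f t0 T0 A0 u1 mf f0 fA]; first by rewrite addr_gt0 ?powR_gt0.
have TV0 : 0 <= T^-1 by rewrite invr_ge0 ltW.
pose h n (tau : R) : R := A * a n * expR (- (tau * (2 ^+ n / T))).
have h0 n tau : 0 <= h n tau by rewrite !mulr_ge0 ?expR_ge0.
have Jh n : J t (h n) = (A * (a n * expR (- (2 ^+ n) `^ beta)))%:E.
  rewrite laplace_exp ?mulr_ge0// ?exprn_ge0// powRM ?exprn_ge0// [t * _]mulrCA u1 mulr1.
  by rewrite mulrA.
(* For [tau >= T] a constant suffices; for smaller [tau] a single dyadic term does. Since all terms
   are nonnegative, their full sum is a majorant that can be integrated term by term. *)
have pw tau : 0 < tau -> f tau <= A * 2 `^ m \/ exists n, f tau <= h n tau.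
  move=> tau0; have y0 : 0 < T / tau by rewrite divr_gt0.
  have [y1|/ltW y1] := leP (T / tau) 1.
    left; apply: (le_trans (fA _ tau0)); rewrite ler_wpM2l//.
    by apply: ge0_ler_powR; rewrite ?nnegrE//; lra.
  right; have [n /andP[ny yn]] := dyadic_ex y1; exists n.
  apply: (le_trans (fA _ tau0)); rewrite /h /a -!mulrA ler_wpM2l//.
  rewrite mulrCA -[leLHS]mulr1; apply: ler_pM; rewrite ?powR_ge0//.
    apply: ge0_ler_powR; rewrite ?nnegrE ?exprn_ge0//; first by lra.
    by rewrite exprS; lra.
  rewrite -expRD -[leLHS]expR0 ler_expR subr_ge0 mulrA.
  by rewrite ler_pdivrMr// mul1r mulrC -ler_pdivlMr.
have mh n : measurable_fun D0 (fun tau => (h n tau * sigma t tau)%:E).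
  by apply: measurable_J => //; exact: measurable_expRZ.
have hs0 n tau : D0 tau -> (0 <= (h n tau * sigma t tau)%:E)%E.
  by move=> tau0; rewrite lee_fin mulr_ge0 ?sigma_ge0.
have mser : measurable_fun D0 (fun tau => \sum_(0 <= n <oo) (h n tau * sigma t tau)%:E)%E.
  by apply: ge0_emeasurable_sum => // n tau tau0 _; exact: hs0.
have c0 : 0 <= A * 2 `^ m by rewrite mulr_ge0 ?powR_ge0.
apply: (@le_trans _ _ (J t (fun=> (A * 2 `^ m)%R) + \sum_(0 <= n <oo) J t (h n))%E).
  rewrite /J -integral_nneseries// -ge0_integralD//; last 3 first.
  - by move=> tau tau0; rewrite lee_fin mulr_ge0 ?sigma_ge0.
  - exact: measurable_J.
  - by move=> tau tau0; apply: nneseries_ge0 => n _ _; exact: hs0.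
  apply: ge0_le_integral => //.
  - move=> tau tau0; rewrite lee_fin mulr_ge0 ?sigma_ge0//.
    by move: tau0; rewrite /= in_itv/= andbT => tau0; exact: f0.
  - exact: measurable_J.
  - by apply: emeasurable_funD => //; exact: measurable_J.
  move=> tau tau0; have s0 := sigma_ge0 t0 tau0.
  have S0 : (0 <= \sum_(0 <= n <oo) (h n tau * sigma t tau)%:E)%E.
    by apply: nneseries_ge0 => n _ _; exact: hs0.
  have tau1 : 0 < tau by move: tau0; rewrite /= in_itv/= andbT.
  have [fl|[n fl]] := pw tau tau1.
    by apply: (@le_trans _ _ (A * 2 `^ m * sigma t tau)%:E); [rewrite lee_fin ler_wpM2r|rewrite leeDl].
  apply: (@le_trans _ _ (h n tau * sigma t tau)%:E); first by rewrite lee_fin ler_wpM2r.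
  apply: (@le_trans _ _ (\sum_(0 <= n <oo) (h n tau * sigma t tau)%:E)%E); last first.
    by rewrite leeDr// lee_fin mulr_ge0.
  apply: (le_trans _ (nneseries_lim_ge n.+1 _)); last by move=> k _ _; exact: hs0.
  by rewrite big_nat_recr//= leeDr// sume_ge0// => k _; exact: hs0.
rewrite laplace_cst// mulrDr EFinD leeD2l//.
apply: (le_trans _ (@epsilon_trick0 R (A * K2) xpredT _)); last by rewrite mulr_ge0// ltW.
apply: lee_nneseries => [n _ _|n _]; first by apply: laplace_ge0.
by rewrite Jh lee_fin -mulrA ler_wpM2l.
Qed.

End Subordinator.

(** * The stable kernel *)

Section StableKernel.
Context {R : realType}.
Variable zeta : R.
Hypothesis hzeta : - 2^-1 < zeta.
Implicit Types t T tau x r s B : R.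

Let m : R := 2^-1 + `|zeta|.

Let m_ge0 : 0 <= m.
Proof. by rewrite addr_ge0. Qed.

Lemma Phi_le_bulk T tau x : 0 < tau -> 0 < T -> 0 <= x ->
  Phi zeta tau x <= Phi zeta T x * (1 + T / tau) `^ m.
Proof.
move=> tau0 T0 x0; have y0 : 0 < T / tau by rewrite divr_gt0.
have P0 := ltW (Phi_gt0 zeta T0 x0).
have [tT|/ltW tT] := leP tau T.
  apply: (le_trans (Phi_time _ tau0 tT x0)).
  rewrite mulrC ler_wpM2l// ge0_ler_powR// ?nnegrE; lra.
apply: (le_trans (Phi_decr hzeta T0 tT x0)); rewrite ler_peMr//.
by rewrite -[leLHS](powRr0 (1 + T / tau)) ler_powR//; lra.
Qed.

(** The factor [1 - e^(-tau/T)] behaves like [min (tau / T) 1] and has an explicit stable integral.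
    For [tau <= T] the Gaussian factor beats the polynomial growth of [Phi] with one power of
    [tau / T] to spare; for [tau >= T] monotonicity of [Phi] is enough. *)
Lemma Phi_exp_le : exists2 K : R, 0 < K & forall T tau x, 0 < tau -> 0 < T -> 0 <= x ->
  Phi zeta tau x * expR (- (T / (4 * tau))) <=
    K * Phi zeta T x * (1 - expR (- (tau / T))).
Proof.
have q0 : 0 < 4^-1 :> R by [].
have [K K0 hK] := powR_le_expR (m + 1) q0.
exists (2 * K + 2) => [|T tau x tau0 T0 x0]; first by rewrite addr_gt0 ?mulr_gt0.
have P0 := ltW (Phi_gt0 zeta T0 x0).
have y0 : 0 < T / tau by rewrite divr_gt0.
have x00 : 0 < tau / T by rewrite divr_gt0.
have [tT|/ltW tT] := leP tau T.
  have y1 : 1 <= T / tau by rewrite ler_pdivlMr// mul1r.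
  have x1 : tau / T <= 1 by rewrite ler_pdivrMr// mul1r.
  have e1 : tau / T <= 2 * (1 - expR (- (tau / T))).
    by have := @expRN_le_half R (tau / T); rewrite (ltW x00) x1 => /(_ isT); lra.
  have e2 : (T / tau) `^ m * expR (- (T / (4 * tau))) <= K * (tau / T).
    rewrite expRN ler_pdivrMr ?expR_gt0// -mulrA [tau / T * _]mulrC mulrA.
    rewrite -[tau / T]invf_div ler_pdivlMr//.
    have -> : T / (4 * tau) = 4^-1 * (T / tau) by field; rewrite gt_eqF.
    apply: le_trans (hK _ (ltW y0)).
    rewrite -[X in _ * X]powRr1 ?(ltW y0)// -powRD ?(gt_eqF y0) ?implybT//.
    by apply: ge0_ler_powR; rewrite ?nnegrE//; have := m_ge0; lra.
  apply: (@le_trans _ _ ((T / tau) `^ m * Phi zeta T x * expR (- (T / (4 * tau))))).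
    by rewrite ler_wpM2r ?expR_ge0//; exact: Phi_time.
  rewrite mulrAC; apply: (@le_trans _ _ (K * (tau / T) * Phi zeta T x)).
    by rewrite ler_wpM2r.
  apply: (@le_trans _ _ (K * (2 * (1 - expR (- (tau / T)))) * Phi zeta T x)).
    by rewrite ler_wpM2r// ler_wpM2l ?(ltW K0).
  have -> : (2 * K + 2) * Phi zeta T x * (1 - expR (- (tau / T))) =
    K * (2 * (1 - expR (- (tau / T)))) * Phi zeta T x +
    2 * (1 - expR (- (tau / T))) * Phi zeta T x by ring.
  by rewrite lerDl mulr_ge0// (le_trans _ e1)// ltW.
have y1 : 1 <= tau / T by rewrite ler_pdivlMr// mul1r.
apply: (@le_trans _ _ (Phi zeta T x * 1)).
  rewrite ler_pM ?expR_ge0 ?(ltW (Phi_gt0 zeta tau0 x0))//; first exact: Phi_decr.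
  by rewrite -[leRHS]expR0 ler_expR oppr_le0 divr_ge0 ?mulr_ge0 ?ltW.
rewrite [(2 * K + 2) * _]mulrC -[leRHS]mulrA ler_wpM2l//.
have : expR (- (tau / T)) <= 2^-1.
  rewrite expRN lef_pV2 ?posrE ?expR_gt0//.
  by have := expR_ge1Dx (tau / T); lra.
by nra.
Qed.

(** [T <= B tau] keeps the Gaussian factor above [e^(-B/4)]. Beyond [T], [Phi] decays only
    polynomially in [tau], hence slower than [e^(-tau/T)]. *)
Lemma Phi_exp_ge B : 0 < B -> exists2 c : R, 0 < c &
  forall T tau x, 0 < tau -> 0 < T -> 0 <= x -> T <= B * tau ->
  c * Phi zeta T x * expR (- (tau / T)) <= Phi zeta tau x * expR (- (T / (4 * tau))).
Proof.
move=> B0; have [K K0 hK] := powR_le_expR m (@ltr01 R).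
have K1 : 1 <= K by have := hK 0 (lexx 0); rewrite addr0 powR1 mulr0 expR0 mulr1.
exists (K^-1 * expR (- (B / 4))) => [|T tau x tau0 T0 x0 TB].
  by rewrite mulr_gt0 ?invr_gt0 ?expR_gt0.
have P0 := ltW (Phi_gt0 zeta T0 x0).
have x00 : 0 < tau / T by rewrite divr_gt0.
have e1 : expR (- (B / 4)) <= expR (- (T / (4 * tau))).
  rewrite ler_expR lerN2 ler_pdivrMr ?mulr_gt0//.
  suff -> : B / 4 * (4 * tau) = B * tau by [].
  by field.
have -> : K^-1 * expR (- (B / 4)) * Phi zeta T x * expR (- (tau / T)) =
  (K^-1 * expR (- (tau / T)) * Phi zeta T x) * expR (- (B / 4)) by ring.
apply: ler_pM => //.
  by apply: mulr_ge0 => //; apply: mulr_ge0; rewrite ?invr_ge0 ?expR_ge0 ?(ltW K0).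
rewrite -mulrA ler_pdivrMl// expRN ler_pdivrMl ?expR_gt0//.
have [Tt|/ltW Tt] := leP T tau.
  apply: (le_trans (Phi_time _ T0 Tt x0)).
  rewrite mulrA ler_wpM2r ?(ltW (Phi_gt0 zeta tau0 x0))//.
  rewrite [leRHS]mulrC; have := hK _ (ltW x00); rewrite mul1r; apply: le_trans.
  by apply: ge0_ler_powR; rewrite ?nnegrE//; have := m_ge0; lra.
apply: (le_trans (Phi_decr hzeta tau0 Tt x0)).
rewrite mulrA ler_peMl ?(ltW (Phi_gt0 zeta tau0 x0))//.
by rewrite mulr_ege1// -[leLHS]expR0 ler_expR ltW.
Qed.

Let p2_ge0 t r s : 0 < t -> 0 < r -> 0 < s -> 0 <= p2 zeta t r s.
Proof.
move=> t0 r0 s0; have [K K0 hK] := p2_bounds hzeta; have [_] := hK t r s t0 r0 s0.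
rewrite -ler_pdivrMl//; apply: le_trans.
have rs0 : 0 <= r * s by rewrite ltW ?mulr_gt0.
apply: mulr_ge0; first by rewrite invr_ge0 ltW.
by apply: mulr_ge0; [exact: ltW (Phi_gt0 zeta t0 rs0)|exact: expR_ge0].
Qed.

Variables (alpha : R) (sigma : R -> R -> R).
Hypothesis halpha : 0 < alpha < 2.
Hypothesis hsigma : subordinator_density (alpha / 2) sigma.

Definition stable_time t r s : R := Num.max ((r - s) ^+ 2) (t `^ (2 / alpha)).

Definition stable_model t r s : R :=
  t * (stable_time t r s)^-1 `^ (alpha / 2) * Phi zeta (stable_time t r s) (r * s).

Lemma stable_time_gt0 t r s : 0 < t -> 0 < stable_time t r s.
Proof. by move=> t0; rewrite lt_max powR_gt0 ?orbT. Qed.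

Lemma palpha_bounds : exists2 K : R, 0 < K & forall t r s, 0 < t -> 0 < r -> 0 < s ->
  palpha alpha sigma zeta t r s <= K * stable_model t r s /\
  stable_model t r s <= K * palpha alpha sigma zeta t r s.
Proof.
have /andP[a0 a2] := halpha.
have hb : 0 < alpha / 2 < 1 by apply/andP; split; lra.
have [K1 K10 h1] := p2_bounds hzeta.
have [K2 K20 h2] := Phi_exp_le.
have [K3 K30 h3] := laplace_upper_bulk hb hsigma m_ge0.
have [B B0 [c c0 h4]] := laplace_lower hb hsigma.
have [c' c'0 h5] := Phi_exp_ge B0.
exists (K1 * K2 + K1 * K3 + K1 / (c * c')) => [|t r s t0 r0 s0].
  by rewrite !addr_gt0 ?mulr_gt0 ?invr_gt0 ?mulr_gt0.
have rs0 : 0 <= r * s by rewrite ltW// mulr_gt0.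
have T0 := stable_time_gt0 r s t0; rewrite /stable_model.
set T := stable_time t r s in T0 *.
have P0 := Phi_gt0 zeta T0 rs0; set P := Phi zeta T (r * s) in P0 *.
set u := t * T^-1 `^ (alpha / 2).
have u0 : 0 < u by rewrite mulr_gt0 ?powR_gt0 ?invr_gt0.
have mp := measurable_p2 hzeta r0 s0.
have p0 tau : 0 < tau -> 0 <= p2 zeta tau r s by move=> tau0; exact: p2_ge0.
set I := (\int[@lebesgue_measure R]_(tau in `]0%R, +oo[) (p2 zeta tau r s * sigma t tau)%:E)%E.
have tT : t `^ (2 / alpha) <= T by rewrite le_max lexx orbT.
have bulk1 : t * (t `^ (2 / alpha))^-1 `^ (alpha / 2) = 1.
  rewrite -powRN -powRrM.
  have -> : - (2 / alpha) * (alpha / 2) = - 1 by field; rewrite gt_eqF.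
  by rewrite powR_inv1 ?(ltW t0)// divff ?gt_eqF.
(* [u] has the order of the probability that the subordinator reaches [T]. It equals 1 exactly when
   [T = t^(2/alpha)], the case treated by the negative moment bound; otherwise [T = (r - s)^2] and
   the tail bound applies. *)
have u1 : u <= 1.
  rewrite -bulk1 ler_wpM2l ?(ltW t0)//; apply: ge0_ler_powR.
  - by rewrite divr_ge0// ltW.
  - by rewrite nnegrE invr_ge0 ltW.
  - by rewrite nnegrE invr_ge0 powR_ge0.
  - by rewrite lef_pV2 ?posrE ?powR_gt0.
have upE : (I <= ((K1 * K2 + K1 * K3) * (u * P))%:E)%E.
  have [dT|dT] := leP (t `^ (2 / alpha)) ((r - s) ^+ 2).
    have TE : T = (r - s) ^+ 2 by rewrite /T /stable_time; exact/max_idPl.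
    have : (I <= (K1 * K2 * P * u)%:E)%E.
      apply: (laplace_upper_tail hb hsigma t0 T0 _ mp p0).
        by rewrite ltW// mulr_gt0// ?mulr_gt0.
      move=> tau tau0; apply: (le_trans (h1 _ _ _ tau0 r0 s0).1).
      rewrite -TE; have -> : K1 * K2 * P * (1 - expR (- (tau / T))) =
        K1 * (K2 * P * (1 - expR (- (tau / T)))) by rewrite !mulrA.
      by rewrite ler_pM2l//; exact: h2.
    move=> /le_trans; apply; rewrite lee_fin mulrDl -mulrA [P * u]mulrC lerDl.
    by rewrite ltW// mulr_gt0// mulr_gt0.
  have TE : T = t `^ (2 / alpha) by rewrite /T /stable_time; apply/max_idPr; exact: ltW.
  have uE : u = 1 by rewrite /u TE.
  have : (I <= (K1 * P * K3)%:E)%E.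
    apply: (h3 t T _ _ t0 T0 _ uE mp p0); first by rewrite ltW// mulr_gt0.
    move=> tau tau0; apply: (le_trans (h1 _ _ _ tau0 r0 s0).1).
    rewrite -[leRHS]mulrA ler_pM2l//; apply: le_trans (Phi_le_bulk tau0 T0 rs0).
    rewrite ler_piMr ?(ltW (Phi_gt0 zeta tau0 rs0))//.
    by rewrite -[leRHS]expR0 ler_expR oppr_le0 divr_ge0 ?sqr_ge0// mulr_ge0// ltW.
  move=> /le_trans; apply; rewrite lee_fin uE mul1r mulrDl [K1 * P * K3]mulrAC lerDr.
  by rewrite ltW// mulr_gt0// ?mulr_gt0.
have loE : ((c * (c' * P / K1 * u))%:E <= I)%E.
  apply: h4 => //; first by rewrite ltW// mulr_gt0 ?invr_gt0// mulr_gt0.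
  move=> tau tau0 TB; have [_ hp] := h1 _ _ _ tau0 r0 s0.
  have := h5 T tau (r * s) tau0 T0 rs0 TB; rewrite -/P => h.
  have e : expR (- (T / (4 * tau))) <= expR (- ((r - s) ^+ 2 / (4 * tau))).
    rewrite ler_expR lerN2 ler_wpM2r ?invr_ge0 ?mulr_ge0 ?(ltW tau0)//.
    by rewrite le_max lexx.
  rewrite mulrAC ler_pdivrMr// [leRHS]mulrC; apply: le_trans hp.
  apply: (le_trans h); rewrite ler_wpM2l ?(ltW (Phi_gt0 zeta tau0 rs0))//.
have I0 : (0 <= I)%E by apply: laplace_ge0 hsigma _ _ t0 p0.
have -> : palpha alpha sigma zeta t r s = fine I by rewrite /palpha lt_eqF.
(* The upper bound rules out [+oo], so [fine] returns the actual value of the integral. *)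
case: I I0 upE loE => [v| |]//; rewrite !lee_fin /= => v0 up lo.
have uP0 : 0 <= u * P by rewrite ltW// mulr_gt0.
have cc : 0 < K1 / (c * c') by rewrite divr_gt0// mulr_gt0.
split; first by rewrite mulrDl (le_trans up)// lerDl mulr_ge0 ?(ltW cc).
have lo' : u * P <= K1 / (c * c') * v.
  apply: le_trans (ler_wpM2l (ltW cc) lo); rewrite le_eqVlt; apply/orP; left; apply/eqP.
  by field; rewrite !gt_eqF.
by rewrite mulrDl (le_trans lo')// lerDr mulr_ge0// ltW// addr_gt0// mulr_gt0.
Qed.

End StableKernel.

(** * Comparison of the model kernels *)

Section ModelComparison.
Context {R : realType}.
Variable zeta : R.
Hypothesis hzeta : - 2^-1 < zeta.
Implicit Types t r s x y L E : R.

(* The slack [d * E] in the exponents pays for the factors [1 + E] elsewhere. *)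
Lemma Phi_exp_compare L (d : R) : 1 <= L -> 0 < d -> exists2 K : R, 0 < K &
  forall t t' x y (e e' : R) E, 0 < t -> 0 < t' -> 0 <= x -> 0 <= y -> 0 <= E ->
    t' <= L * (1 + E) * t -> x <= L * (1 + E) * (t + y) -> y <= L * (1 + E) * (t + x) ->
    e' + d * E <= e + L ->
    Phi zeta t x * expR (- e) <= K * (Phi zeta t' y * expR (- e')).
Proof.
move=> L1 d0; have L0 : 0 < L by exact: lt_le_trans L1.
pose m : R := 2^-1 + `|zeta|; pose n : R := `|zeta| + m.
have m0 : 0 <= m by rewrite addr_ge0.
have [K K0 hK] := powR_le_expR n d0.
exists ((2 * L) `^ n * K * expR L).
  by rewrite !mulr_gt0 ?powR_gt0 ?expR_gt0// mulr_gt0.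
move=> t t' x y e e' E t0 t'0 x0 y0 E0 ht hx hy he.
have E1 : 0 < 1 + E by rewrite ltr_pwDl.
set M := L * (1 + E) in ht hx hy.
have M1 : 1 <= M by rewrite mulr_ege1// lerDl.
have M0 : 0 < M by exact: lt_le_trans M1.
have P : Phi zeta t x <= (2 * L) `^ n * (K * expR (d * E)) * Phi zeta t' y.
  apply: (le_trans (Phi_arg zeta t0 x0 y0 (ltW M0) hx hy)).
  have tM : t <= M * t by rewrite ler_peMl// ltW.
  have := Phi_time zeta t0 tM y0; rewrite mulfK ?gt_eqF// -/m => h1.
  have h2 := Phi_decr hzeta t'0 ht y0.
  apply: (@le_trans _ _ ((2 * M) `^ `|zeta| * ((2 * M) `^ m * Phi zeta t' y))).
    apply: ler_pM; rewrite ?powR_ge0 ?(ltW (Phi_gt0 zeta t0 y0))//.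
      by apply: ge0_ler_powR; rewrite ?nnegrE//; lra.
    apply: (le_trans h1); apply: ler_pM => //; rewrite ?powR_ge0//.
      by rewrite ltW// Phi_gt0// mulr_gt0.
    by apply: ge0_ler_powR; rewrite ?nnegrE//; lra.
  have M20 : 0 < 2 * M by rewrite mulr_gt0.
  rewrite mulrA -powRD ?(gt_eqF M20) ?implybT// -/n.
  rewrite ler_wpM2r ?(ltW (Phi_gt0 zeta t'0 y0))// /M mulrA powRM ?(ltW E1) ?mulr_ge0 ?(ltW L0)//.
  by rewrite ler_wpM2l ?powR_ge0// hK.
apply: (le_trans (ler_wpM2r (expR_ge0 _) P)).
have -> : (2 * L) `^ n * (K * expR (d * E)) * Phi zeta t' y * expR (- e) =
  (2 * L) `^ n * K * Phi zeta t' y * (expR (d * E) * expR (- e)) by ring.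
have -> : (2 * L) `^ n * K * expR L * (Phi zeta t' y * expR (- e')) =
  (2 * L) `^ n * K * Phi zeta t' y * (expR L * expR (- e')) by ring.
rewrite -!expRD ler_wpM2l ?ler_expR//; last by lra.
by rewrite !mulr_ge0 ?powR_ge0 ?(ltW K0) ?(ltW (Phi_gt0 zeta t'0 y0)).
Qed.

Variable alpha : R.

(** Only an upper bound on the new stable time is required, since [T^(-alpha/2)] and [Phi] both
    decrease in [T]. The products [r s] need to agree only modulo [T]. *)
Lemma stable_model_le L : 0 < alpha < 2 -> 1 <= L -> exists2 K : R, 0 < K &
  forall t r s t' r' s', 0 < t -> 0 < r -> 0 < s -> 0 < t' -> 0 < r' -> 0 < s' ->
    t <= L * t' -> stable_time alpha t' r' s' <= L * stable_time alpha t r s ->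
    r * s <= L * (stable_time alpha t r s + r' * s') ->
    r' * s' <= L * (stable_time alpha t r s + r * s) ->
    stable_model zeta alpha t r s <= K * stable_model zeta alpha t' r' s'.
Proof.
move=> /andP[a0 a2] L1; have L0 : 0 < L by exact: lt_le_trans L1.
have b0 : 0 <= alpha / 2 by rewrite divr_ge0 ?ltW.
have [K K0 hK] := Phi_le hzeta L1.
exists (L * L `^ (alpha / 2) * K) => [|t r s t' r' s' t0 r0 s0 t'0 r'0 s'0 tL TL xy yx].
  by rewrite !mulr_gt0 ?powR_gt0.
have T0 := stable_time_gt0 alpha r s t0; have T'0 := stable_time_gt0 alpha r' s' t'0.
have rs0 : 0 <= r * s by rewrite ltW// mulr_gt0.
have rs'0 : 0 <= r' * s' by rewrite ltW// mulr_gt0.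
have P := hK _ _ _ _ T0 T'0 rs0 rs'0 TL xy yx.
rewrite /stable_model; set T := stable_time alpha t r s in T0 TL xy yx P *.
set T' := stable_time alpha t' r' s' in T'0 TL P *.
have -> : L * L `^ (alpha / 2) * K * (t' * T'^-1 `^ (alpha / 2) * Phi zeta T' (r' * s')) =
  (L * t' * (L `^ (alpha / 2) * T'^-1 `^ (alpha / 2))) * (K * Phi zeta T' (r' * s')) by ring.
rewrite -powRM ?invr_ge0 ?(ltW L0) ?(ltW T'0)//.
apply: ler_pM => //.
- by rewrite mulr_ge0 ?powR_ge0 ?(ltW t0).
- by rewrite ltW// Phi_gt0.
apply: ler_pM; rewrite ?powR_ge0 ?(ltW t0)//.
apply: ge0_ler_powR => //; rewrite ?nnegrE ?invr_ge0 ?(ltW T0) ?divr_ge0 ?(ltW L0) ?(ltW T'0)//.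
by rewrite ler_pdivlMr// mulrC ler_pdivrMr.
Qed.

Definition kernel_model t r s : R := if alpha == 2
  then Phi zeta t (r * s) * expR (- ((r - s) ^+ 2 / (4 * t)))
  else stable_model zeta alpha t r s.

Lemma kernel_model_gt0 t r s : 0 < t -> 0 < r -> 0 < s -> 0 < kernel_model t r s.
Proof.
move=> t0 r0 s0; have rs0 : 0 <= r * s by rewrite ltW// mulr_gt0.
rewrite /kernel_model; case: ifPn => _.
  by apply: mulr_gt0; [exact: Phi_gt0|exact: expR_gt0].
have T0 := stable_time_gt0 alpha r s t0.
apply: mulr_gt0; last exact: Phi_gt0.
by rewrite mulr_gt0// powR_gt0// invr_gt0.
Qed.

Lemma palpha_model (sigma : R -> R -> R) : admissible alpha sigma ->
  exists2 K : R, 0 < K & forall t r s, 0 < t -> 0 < r -> 0 < s ->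
    palpha alpha sigma zeta t r s <= K * kernel_model t r s /\
    kernel_model t r s <= K * palpha alpha sigma zeta t r s.
Proof.
move=> [/andP[a0 a2] hs]; rewrite /kernel_model.
have [a|a] := eqVneq alpha 2.
  have [K K0 hK] := p2_bounds hzeta; exists K => // t r s t0 r0 s0.
  by rewrite /palpha a eqxx; exact: hK.
have a2' : alpha < 2 by rewrite lt_neqAle a.
apply: palpha_bounds => //; last exact: hs.
by rewrite a0.
Qed.

Lemma palpha_compare (sigma : R -> R -> R) : admissible alpha sigma ->
  exists2 K : R, 0 < K & forall (C : R) t r s t' r' s', 0 <= C ->
    0 < t -> 0 < r -> 0 < s -> 0 < t' -> 0 < r' -> 0 < s' ->
    kernel_model t r s <= C * kernel_model t' r' s' ->
    palpha alpha sigma zeta t r s <= K * C * palpha alpha sigma zeta t' r' s'.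
Proof.
move=> /palpha_model[K K0 hK]; exists (K * K); first by rewrite mulr_gt0.
move=> C t r s t' r' s' C0 t0 r0 s0 t'0 r'0 s'0 h.
have [h1 _] := hK t r s t0 r0 s0; have [_ h2] := hK t' r' s' t'0 r'0 s'0.
apply: (le_trans h1); rewrite -!mulrA ler_pM2l// (le_trans h)//.
by rewrite mulrCA ler_wpM2l.
Qed.

Lemma stable_timeP t r s (B : R) :
  (r - s) ^+ 2 <= B -> t `^ (2 / alpha) <= B -> stable_time alpha t r s <= B.
Proof. by move=> h1 h2; rewrite ge_max h1. Qed.

Lemma stable_time_ge t r s : 0 < t ->
  [/\ 0 < stable_time alpha t r s, (r - s) ^+ 2 <= stable_time alpha t r s &
      t `^ (2 / alpha) <= stable_time alpha t r s].
Proof. by move=> t0; rewrite stable_time_gt0// !le_max !lexx orbT. Qed.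

End ModelComparison.

(** * The parts of the theorem for the model kernels *)

Section ModelParts.
Context {R : realType}.
Variable zeta : R.
Hypothesis hzeta : - 2^-1 < zeta.
Implicit Types t tau z r s x y L Q : R.

Lemma gauss_compare L (d : R) : 1 <= L -> 0 < d -> exists2 K : R, 0 < K &
  forall t t' x y (e e' : R) Q, 0 < t -> 0 < t' -> 0 <= x -> 0 <= y -> 0 <= Q ->
    t' <= L * (t + Q) -> x <= L * (t + Q + y) -> y <= L * (t + Q + x) ->
    e' + d * Q / t <= e + L ->
    Phi zeta t x * expR (- e) <= K * (Phi zeta t' y * expR (- e')).
Proof.
move=> L1 d0; have L0 : 0 <= L by lra.
have [K K0 hK] := Phi_exp_compare hzeta L1 d0.
exists K => // t t' x y e e' Q t0 t'0 x0 y0 Q0 ht hx hy he.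
have QE : Q / t * t = Q by rewrite divfK ?gt_eqF.
have Qt0 : 0 <= Q / t by rewrite divr_ge0// ltW.
have up v : 0 <= v -> L * (t + Q + v) <= L * (1 + Q / t) * (t + v).
  move=> v0; rewrite -mulrA ler_wpM2l//.
  have -> : (1 + Q / t) * (t + v) = t + Q + v + Q / t * v by rewrite -{2}QE; ring.
  by rewrite lerDl mulr_ge0.
apply: (hK _ _ _ _ _ _ (Q / t)) => //.
- by have := up 0 (lexx 0); rewrite !addr0; apply: le_trans.
- exact: le_trans (up _ y0).
- exact: le_trans (up _ x0).
- by rewrite mulrA.
Qed.

Let far z s : 0 < z -> z <= s / 2 -> 
  [/\ 0 < s, s ^+ 2 <= 4 * (z - s) ^+ 2, z * s <= s ^+ 2 & 0 <= z * s].
Proof.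
move=> z0 zs; have s0 : 0 < s by lra.
(* The two factors come from [4 (z - s)^2 - s^2 = (s - 2 z) (3 s - 2 z)]. *)
have sz : 0 <= s - 2 * z by lra.
have sz3 : 0 <= 3 * s - 2 * z by lra.
have h1 := mulr_ge0 sz sz3; have h2 := mulr_ge0 sz (ltW s0).
have h3 : 0 <= z * s by rewrite mulr_ge0// ltW.
by split => //; lra.
Qed.

Lemma kernel_model_bound (alpha : R) : 0 < alpha <= 2 -> exists2 K : R, 0 < K &
  forall tau z s, 0 < tau -> 0 < z -> z <= s / 2 ->
    kernel_model zeta alpha tau z s <= K * model_bound zeta alpha 32^-1 tau s.
Proof.
move=> /andP[a0 a2]; rewrite /kernel_model /model_bound; have [a|a] := eqVneq alpha 2.
  (* The exponent is at least [s^2 / (16 tau)]; one half becomes the exponent of the bound, the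
     other half is the slack. *)
  have d0 : 0 < 32^-1 :> R by [].
  have [K K0 hK] := gauss_compare (lexx 1) d0; exists K => // tau z s t0 z0 zs.
  have [s0 h1 h2 h3] := far z0 zs.
  have -> : tau `^ (- 2^-1) * expR (- (32^-1 * s ^+ 2 / tau)) / (tau + s ^+ 2) `^ zeta =
     Phi zeta tau (s ^+ 2) * expR (- (32^-1 * s ^+ 2 / tau)) by rewrite /Phi powRN mulrAC.
  apply: (hK _ _ _ _ _ _ (s ^+ 2)) => //; try nra.
  rewrite invfM !mulrA -mulrDl; have w0 : 0 < tau^-1 by rewrite invr_gt0.
  have h : 32^-1 * s ^+ 2 + 32^-1 * s ^+ 2 <= (z - s) ^+ 2 / 4 by lra.
  by have := ler_wpM2r (ltW w0) h; lra.
have al2 : alpha < 2 by rewrite lt_neqAle a.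
have L1 : 1 <= 4 :> R by rewrite ler1n.
have [K K0 hK] := Phi_le hzeta L1.
pose p := 2 * zeta + 1 + alpha; have p0 : 0 < p by rewrite /p; move: hzeta; lra.
exists (4 `^ (alpha / 2) * K * 2 `^ (- zeta) * 2) => [|tau z s t0 z0 zs].
  by rewrite !mulr_gt0 ?powR_gt0.
have [s0 h1 h2 h3] := far z0 zs.
have [T0 T1 T2] := stable_time_ge alpha z s t0.
rewrite /stable_model; set T := stable_time alpha tau z s in T0 T1 T2 *.
(* [W] is the length scale of the target: [W^2 <= 4 T] bounds the kernel by a multiple of
   [tau W^(-p)], while the denominator of the target is at most [2 W^p]. *)
pose W := Num.max s (tau `^ alpha^-1).
have W0 : 0 < W by rewrite lt_max s0.
have WT : W ^+ 2 <= 4 * T.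
  rewrite /W; case: (leP s (tau `^ alpha^-1)) => _; last by lra.
  rewrite -powR_mulrn ?powR_ge0// -powRrM mulrC; lra.
have sW : s <= W by rewrite le_max lexx.
have W20 : 0 < W ^+ 2 by rewrite exprn_gt0.
have sW2 : s ^+ 2 <= W ^+ 2 by rewrite ler_sqr ?nnegrE ?(ltW s0) ?(ltW W0).
have P : Phi zeta T (z * s) <= K * Phi zeta (W ^+ 2) (W ^+ 2) by apply: hK => //; lra.
have W2 y : (W ^+ 2) `^ y = W `^ (2 * y) by rewrite -powR_mulrn ?(ltW W0)// -powRrM.
have PW : Phi zeta (W ^+ 2) (W ^+ 2) = 2 `^ (- zeta) * W `^ (- (2 * zeta + 1)).
  have -> : Phi zeta (W ^+ 2) (W ^+ 2) = (W ^+ 2) `^ (- 2^-1) * (2 * W ^+ 2) `^ (- zeta).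
    by congr (_ * _ `^ _); ring.
  rewrite [(2 * _) `^ _]powRM ?(ltW W20)// !W2 mulrCA -powRD ?(gt_eqF W0) ?implybT//.
  by congr (_ * _ `^ _); field.
have TW : T^-1 `^ (alpha / 2) <= 4 `^ (alpha / 2) * W `^ (- alpha).
  have -> : W `^ (- alpha) = (W ^+ 2)^-1 `^ (alpha / 2).
    by rewrite -[W ^- 2]powR_inv1 ?(ltW W20)// -powRrM W2; congr (_ `^ _); field.
  rewrite -powRM ?invr_ge0 ?(ltW W20)//; apply: ge0_ler_powR.
  - by rewrite divr_ge0// ltW.
  - by rewrite nnegrE invr_ge0 ltW.
  - by rewrite nnegrE divr_ge0// ltW.
  - by rewrite ler_pdivlMr// mulrC ler_pdivrMr.
rewrite -/p; have Wp : s `^ p + tau `^ (p / alpha) <= 2 * W `^ p.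
  have pp := ltW p0.
  have : s `^ p <= W `^ p by apply: ge0_ler_powR; rewrite ?nnegrE ?(ltW s0) ?(ltW W0).
  have : tau `^ (p / alpha) <= W `^ p.
    rewrite mulrC powRrM; apply: ge0_ler_powR; rewrite ?nnegrE ?powR_ge0 ?(ltW W0)//.
    by rewrite le_max lexx orbT.
  by lra.
have D0 : 0 < s `^ p + tau `^ (p / alpha) by rewrite addr_gt0 ?powR_gt0.
apply: (@le_trans _ _ (tau * (4 `^ (alpha / 2) * W `^ (- alpha)) *
    (K * (2 `^ (- zeta) * W `^ (- (2 * zeta + 1)))))).
  rewrite -PW; apply: ler_pM => //.
  - by rewrite mulr_ge0 ?powR_ge0 ?(ltW t0).
  - by rewrite ltW// Phi_gt0.
  - by rewrite ler_wpM2l ?(ltW t0).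
have -> : tau * (4 `^ (alpha / 2) * W `^ (- alpha)) * (K * (2 `^ (- zeta) * W `^ (- (2 * zeta + 1)))) =
   4 `^ (alpha / 2) * K * 2 `^ (- zeta) * (tau * (W `^ (- alpha) * W `^ (- (2 * zeta + 1)))) by ring.
rewrite -powRD ?(gt_eqF W0) ?implybT//.
have -> : - alpha - (2 * zeta + 1) = - p by rewrite /p; ring.
rewrite -[leRHS]mulrA ler_wpM2l ?mulr_ge0 ?powR_ge0 ?(ltW K0)//.
rewrite [leRHS]mulrCA ler_wpM2l ?(ltW t0)// powRN -div1r ler_pdivrMr ?powR_gt0//.
by rewrite mulrAC ler_pdivlMr// mul1r.
Qed.

Lemma model_bound_le (alpha : R) : 0 < alpha <= 2 -> exists2 K : R, 0 < K &
  forall tau s, 0 < tau -> 0 < s ->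
    model_bound zeta alpha 32^-1 tau s <= K * s `^ (- (2 * zeta + 1)).
Proof.
move=> /andP[a0 a2]; rewrite /model_bound; have [a|a] := eqVneq alpha 2.
  have d0 : 0 < 32^-1 :> R by [].
  have [K K0 hK] := gauss_compare (lexx 1) d0.
  exists (K * 2 `^ (- zeta)) => [|tau s t0 s0]; first by rewrite mulr_gt0 ?powR_gt0.
  have s20 : 0 < s ^+ 2 by rewrite exprn_gt0.
  have -> : tau `^ (- 2^-1) * expR (- (32^-1 * s ^+ 2 / tau)) / (tau + s ^+ 2) `^ zeta =
     Phi zeta tau (s ^+ 2) * expR (- (32^-1 * s ^+ 2 / tau)) by rewrite /Phi powRN mulrAC.
  have := hK tau (s ^+ 2) (s ^+ 2) (s ^+ 2) (32^-1 * s ^+ 2 / tau) 0 (s ^+ 2) t0 s20.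
  rewrite oppr0 expR0 mulr1 => /(_ (ltW s20) (ltW s20) (ltW s20)) h.
  apply: (le_trans (h _ _ _ _)); try lra.
  have W2 y : (s ^+ 2) `^ y = s `^ (2 * y) by rewrite -powR_mulrn ?(ltW s0)// -powRrM.
  rewrite -mulrA ler_wpM2l ?(ltW K0)//.
  have -> : Phi zeta (s ^+ 2) (s ^+ 2) = (s ^+ 2) `^ (- 2^-1) * (2 * s ^+ 2) `^ (- zeta).
    by congr (_ * _ `^ _); ring.
  rewrite [(2 * _) `^ _]powRM ?(ltW s20)// !W2 mulrCA -powRD ?(gt_eqF s0) ?implybT//.
  suff -> : 2 * - 2^-1 + 2 * - zeta = - (2 * zeta + 1) by [].
  by field.
pose q := 2 * zeta + 1; have q0 : 0 < q by rewrite /q; move: hzeta; lra.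
exists 1 => // tau s t0 s0; rewrite mul1r -/q powRN.
have D0 : 0 < s `^ (q + alpha) + tau `^ ((q + alpha) / alpha).
  by rewrite addr_gt0 ?powR_gt0.
rewrite ler_pdivrMr// mulrC ler_pdivlMr ?powR_gt0//.
(* The threshold is where the two terms of the denominator are equal; in each range the larger one
   alone suffices. *)
have [h|h] := leP tau (s `^ alpha).
  rewrite (@powRD _ s q alpha) ?(gt_eqF s0) ?implybT// mulrC.
  have := ler_wpM2l (powR_ge0 s q) h; have := powR_ge0 tau ((q + alpha) / alpha); lra.
have -> : (q + alpha) / alpha = 1 + q / alpha by field; rewrite gt_eqF.
rewrite (@powRD _ tau 1) ?(gt_eqF t0) ?implybT// powRr1 ?(ltW t0)//.
have : s `^ q <= tau `^ (q / alpha).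
  have -> : s `^ q = (s `^ alpha) `^ (q / alpha).
    by rewrite -powRrM mulrCA divff ?mulr1// gt_eqF.
  by apply: ge0_ler_powR; rewrite ?nnegrE ?powR_ge0 ?(ltW t0) ?(ltW h)// divr_ge0 ?ltW.
move=> /(ler_wpM2l (ltW t0)); have := powR_ge0 s (q + alpha); lra.
Qed.

Lemma kernel_model_far (alpha C : R) : 0 < alpha <= 2 -> 0 < C -> exists2 K : R, 0 < K &
  forall tau z s, C < tau -> 0 < z -> z <= s / 2 ->
    kernel_model zeta alpha tau z s <= K * kernel_model zeta alpha tau 32^-1 (32^-1 * s).
Proof.
move=> /andP[a0 a2] C0; rewrite /kernel_model; have [a|a] := eqVneq alpha 2.
  have d0 : 0 < 32^-1 :> R by [].
  have CV0 : 0 < C^-1 by rewrite invr_gt0.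
  have L1 : 1 <= 1 + C^-1 by lra.
  have [K K0 hK] := gauss_compare L1 d0; exists K => // tau z s tC z0 zs.
  have t0 : 0 < tau by exact: lt_trans tC.
  have [s0 h1 h2 h3] := far z0 zs.
  have tC1 : 1 <= C^-1 * tau by rewrite -ler_pdivrMl ?invr_gt0// invrK mulr1 ltW.
  have w0 : 0 < tau^-1 by rewrite invr_gt0.
  have wC : tau^-1 <= C^-1 by rewrite lef_pV2 ?posrE// ltW.
  have s1 : s <= 1 + s ^+ 2 by have := sqr_ge0 (s - 1); nra.
  have s20 := sqr_ge0 s; have Cs := mulr_ge0 (ltW CV0) s20.
  have Czs := mulr_ge0 (ltW CV0) h3; have CVs := mulr_ge0 (ltW CV0) (ltW s0).
  apply: (hK _ _ _ _ _ _ (s ^+ 2)) => //; try lra.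
  rewrite !invfM !mulrA -mulrDl.
  (* Replacing [z] by a fixed point costs an additive 1 in the squared distances. After division by
     [tau > C] it is at most [1 / C], which is part of the constant [L]. *)
  have h : (32^-1 - 32^-1 * s) ^+ 2 / 4 + 32^-1 * s ^+ 2 <= (z - s) ^+ 2 / 4 + 1 by lra.
  by have := ler_wpM2r (ltW w0) h; lra.
have al2 : alpha < 2 by rewrite lt_neqAle a.
have ha : 0 < alpha < 2 by rewrite a0.
pose c := (C `^ (2 / alpha))^-1; have c0 : 0 < c by rewrite invr_gt0 powR_gt0.
have L1 : 1 <= 8 + c by lra.
have [K K0 hK] := stable_model_le hzeta ha L1; exists K => // tau z s tC z0 zs.
have t0 : 0 < tau by exact: lt_trans tC.
have [s0 h1 h2 h3] := far z0 zs.
have [T0 T1 T2] := stable_time_ge alpha z s t0.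
have T3 : 1 <= c * stable_time alpha tau z s.
  rewrite /c -div1r mulrAC mul1r ler_pdivlMr ?powR_gt0// mul1r (le_trans _ T2)//.
  by apply: ge0_ler_powR; rewrite ?nnegrE ?divr_ge0 ?(ltW a0) ?(ltW C0) ?(ltW t0) ?(ltW tC).
have s1 : s <= 1 + s ^+ 2 by have := sqr_ge0 (s - 1); nra.
have ct := mulr_ge0 (ltW c0) (ltW t0); have cs := mulr_ge0 (ltW c0) (ltW s0).
have czs := mulr_ge0 (ltW c0) h3.
apply: hK; rewrite ?mulr_gt0//; try lra.
by apply: stable_timeP; lra.
Qed.

(** The hypothesis [C <= s] stands in for a lower bound on the time: [1 <= s^2 / C^2], so moving
    from [tau] to time 1 is an error of order [s^2], which the separation of [z] and [s] pays
    for. *)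
Lemma kernel_model_short (alpha C : R) : 0 < alpha <= 2 -> 0 < C -> exists2 K : R, 0 < K &
  forall tau z s, 0 < tau <= 1 -> 0 < z -> z <= s / 2 -> C <= s ->
    kernel_model zeta alpha tau z s <= K * kernel_model zeta alpha 1 32^-1 (32^-1 * s).
Proof.
move=> /andP[a0 a2] C0; rewrite /kernel_model.
have CV0 : 0 < (C ^+ 2)^-1 by rewrite invr_gt0 exprn_gt0.
have Cs s : C <= s -> 1 <= (C ^+ 2)^-1 * s ^+ 2.
  move=> sC; rewrite -ler_pdivrMl ?invr_gt0 ?exprn_gt0// invrK mulr1.
  by rewrite ler_sqr ?nnegrE//; lra.
have [a|a] := eqVneq alpha 2.
  have d0 : 0 < 64^-1 :> R by [].
  have L1 : 1 <= 1 + (C ^+ 2)^-1 by lra.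
  have [K K0 hK] := gauss_compare L1 d0; exists K => // tau z s /andP[t0 t1] z0 zs sC.
  have [s0 h1 h2 h3] := far z0 zs; have s1 := Cs _ sC.
  have w1 : 1 <= tau^-1 by rewrite invf_ge1.
  have s2 : s <= 1 + s ^+ 2 by have := sqr_ge0 (s - 1); nra.
  have s20 := sqr_ge0 s.
  have Ct := mulr_ge0 (ltW CV0) (ltW t0); have CVs := mulr_ge0 (ltW CV0) (ltW s0).
  have Czs := mulr_ge0 (ltW CV0) h3.
  apply: (hK _ _ _ _ _ _ (s ^+ 2)) => //; try lra.
  rewrite !invfM !mulrA invr1 mulr1.
  have h : (32^-1 - 32^-1 * s) ^+ 2 / 4 <= 64^-1 * s ^+ 2 + 1 by lra.
  have h4 : 64^-1 * s ^+ 2 <= 64^-1 * s ^+ 2 / tau by rewrite ler_peMr// mulr_ge0// sqr_ge0.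
  have h5 : 64^-1 * s ^+ 2 + 64^-1 * s ^+ 2 <= (z - s) ^+ 2 / 4 by lra.
  by have := ler_wpM2r (le_trans ler01 w1) h5; lra.
have al2 : alpha < 2 by rewrite lt_neqAle a.
have ha : 0 < alpha < 2 by rewrite a0.
have L1 : 1 <= 8 + 4 * (C ^+ 2)^-1 by lra.
have [K K0 hK] := stable_model_le hzeta ha L1; exists K => // tau z s /andP[t0 t1] z0 zs sC.
have [s0 h1 h2 h3] := far z0 zs; have s1 := Cs _ sC.
have [T0 T1 T2] := stable_time_ge alpha z s t0.
have sT : s ^+ 2 <= 4 * stable_time alpha tau z s by lra.
have T3 : 1 <= 4 * (C ^+ 2)^-1 * stable_time alpha tau z s.
  by have := ler_wpM2l (ltW CV0) sT; lra.
have s2 : s <= 1 + s ^+ 2 by have := sqr_ge0 (s - 1); nra.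
have CVs := mulr_ge0 (ltW CV0) (ltW s0); have Czs := mulr_ge0 (ltW CV0) h3.
apply: hK; rewrite ?mulr_gt0//; try lra.
by apply: stable_timeP; rewrite ?powR1; lra.
Qed.

(** Since [0 < r <= s], the halved points are at distance at most [s / 2], whereas 1 and [s] are at
    distance close to [s] when [s] is large; the difference of the squares is the slack. *)
Lemma kernel_model_min (alpha : R) : 0 < alpha <= 2 -> exists2 K : R, 0 < K &
  forall r s, 0 < r -> r <= s ->
    kernel_model zeta alpha 1 1 s <= K * kernel_model zeta alpha 1 (2^-1 * r) (2^-1 * s).
Proof.
move=> /andP[a0 a2]; rewrite /kernel_model; have [a|a] := eqVneq alpha 2.
  have d0 : 0 < 16^-1 :> R by [].
  have [K K0 hK] := gauss_compare (lexx 1) d0; exists K => // r s r0 rs.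
  have s0 : 0 < s by exact: lt_le_trans rs.
  have rs0 : 0 <= r * s by rewrite mulr_ge0// ltW.
  have rs2 : r * s <= s ^+ 2 by rewrite expr2 ler_wpM2r// ltW.
  have r2 : 0 <= r ^+ 2 by exact: sqr_ge0.
  have r2s : r ^+ 2 <= r * s by rewrite expr2 ler_wpM2l// ltW.
  have := sqr_ge0 (s - 1); have := sqr_ge0 (s - 2) => q1 q2.
  by apply: (hK _ _ _ _ _ _ (s ^+ 2)) => //; rewrite ?mulr1 ?invr1 ?mulr1; lra.
have al2 : alpha < 2 by rewrite lt_neqAle a.
have ha : 0 < alpha < 2 by rewrite a0.
have L1 : 1 <= 8 :> R by rewrite ler1n.
have [K K0 hK] := stable_model_le hzeta ha L1; exists K => // r s r0 rs.
have s0 : 0 < s by exact: lt_le_trans rs.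
have [T0 T1 T2] := stable_time_ge alpha 1 s (@ltr01 R).
rewrite powR1 in T2.
have rs0 : 0 <= r * s by rewrite mulr_ge0// ltW.
have rs2 : r * s <= s ^+ 2 by rewrite expr2 ler_wpM2r// ltW.
have r2s : r ^+ 2 <= r * s by rewrite expr2 ler_wpM2l// ltW.
have := sqr_ge0 (s - 1); have := sqr_ge0 (s - 2) => q1 q2.
apply: hK; rewrite ?mulr_gt0 ?ltr01//; try lra.
by apply: stable_timeP; rewrite ?powR1; lra.
Qed.

(** Both [r] and [z] lie within [2 |z - s|] of [s], so [r s] and [z s] are each comparable with
    [s^2] modulo multiples of [(z - s)^2]. *)
Let near_prod r s z : 0 < r -> 0 < s -> 0 < z -> `|r - s| / 2 < `|z - s| ->
  [/\ (r - s) ^+ 2 <= 4 * (z - s) ^+ 2, r * s <= 4 * (z * s + (z - s) ^+ 2) &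
      z * s <= 7 * (r * s + (z - s) ^+ 2)].
Proof.
move=> r0 s0 z0 h.
have h1 : (r - s) ^+ 2 <= 4 * (z - s) ^+ 2.
  rewrite -(real_normK (num_real (r - s))) -(real_normK (num_real (z - s))).
  by have := normr_ge0 (r - s); have := normr_ge0 (z - s); nra.
have q1 := sqr_ge0 z; have q2 := sqr_ge0 (s - (r - s)); have q3 := sqr_ge0 s.
have q4 := sqr_ge0 (s - (z - s)); have q5 := sqr_ge0 r.
have rs0 : 0 <= r * s by rewrite mulr_ge0// ltW.
by split => //; lra.
Qed.

Lemma kernel_model_near (alpha : R) : 0 < alpha <= 2 -> exists2 K : R, 0 < K &
  forall r s z t, 0 < r -> 0 < s -> 0 < z -> 0 < t -> `|r - s| / 2 < `|z - s| ->
    kernel_model zeta alpha t z s <= K * kernel_model zeta alpha t (4^-1 * r) (4^-1 * s).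
Proof.
move=> /andP[a0 a2]; rewrite /kernel_model.
(* [112 = 16 * 7]: dilation by [1/4] divides the product [r s] by 16, and 7 is the constant in the
   comparison of the products. *)
have L1 : 1 <= 112 :> R by rewrite ler1n.
have [a|a] := eqVneq alpha 2.
  have d0 : 0 < 16^-1 :> R by [].
  have [K K0 hK] := gauss_compare L1 d0; exists K => // r s z t r0 s0 z0 t0 h.
  have [h1 h2 h3] := near_prod r0 s0 z0 h.
  have zs0 : 0 < z * s by rewrite mulr_gt0.
  have rs0 : 0 < r * s by rewrite mulr_gt0.
  have E : 4^-1 * r * (4^-1 * s) = 16^-1 * (r * s) by field.
  have w0 : 0 < t^-1 by rewrite invr_gt0.
  have e0 := sqr_ge0 (z - s).
  apply: (hK _ _ _ _ _ _ ((z - s) ^+ 2)); rewrite ?E//; try lra.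
  rewrite !invfM !mulrA -mulrDl.
  have g : (4^-1 * r - 4^-1 * s) ^+ 2 / 4 + 16^-1 * (z - s) ^+ 2 <= (z - s) ^+ 2 / 4 by lra.
  by have := ler_wpM2r (ltW w0) g; lra.
have al2 : alpha < 2 by rewrite lt_neqAle a.
have ha : 0 < alpha < 2 by rewrite a0.
have [K K0 hK] := stable_model_le hzeta ha L1; exists K => // r s z t r0 s0 z0 t0 h.
have [h1 h2 h3] := near_prod r0 s0 z0 h.
have zs0 : 0 < z * s by rewrite mulr_gt0.
have rs0 : 0 < r * s by rewrite mulr_gt0.
have E : 4^-1 * r * (4^-1 * s) = 16^-1 * (r * s) by field.
have [T0 T1 T2] := stable_time_ge alpha z s t0.
have e0 := sqr_ge0 (z - s).
apply: hK; rewrite ?E ?mulr_gt0//; try lra.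
by apply: stable_timeP; lra.
Qed.

(** The dilations multiply squared distances by [C^-2 >= tau^-1] and by [C^2 <= tau^-1]. The
    exponents are therefore already ordered, and no slack is spent ([Q = 0]). *)
Lemma gauss_time (C : R) : 0 < C <= 1 -> exists2 K : R, 0 < K &
  forall z s tau, 0 < z -> 0 < s -> C <= tau <= C^-1 ->
    kernel_model zeta 2 1 (C^-1 * z) (C^-1 * s) <= K * kernel_model zeta 2 tau z s /\
    kernel_model zeta 2 tau z s <= K * kernel_model zeta 2 1 (C * z) (C * s).
Proof.
move=> /andP[C0 C1]; have d0 : 0 < 1 :> R by [].
have CV0 : 0 < C^-1 by rewrite invr_gt0.
have CV1 : 1 <= C^-1 by rewrite invf_ge1.
have L1 : 1 <= C^-1 ^+ 2 by rewrite exprn_ege1.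
have [K K0 hK] := gauss_compare L1 d0; exists K => // z s tau z0 s0 /andP[t1 t2].
have t0 : 0 < tau by exact: lt_le_trans t1.
have w0 : 0 < tau^-1 by rewrite invr_gt0.
have wC : tau^-1 <= C^-1 by rewrite lef_pV2 ?posrE.
have Cw : C <= tau^-1 by rewrite -[C]invrK lef_pV2 ?posrE.
have zs0 : 0 < z * s by rewrite mulr_gt0.
have e0 := sqr_ge0 (z - s).
have CC : C^-1 * C = 1 by rewrite mulVf ?gt_eqF.
have Ct : 1 <= C^-1 * tau by rewrite -CC ler_pM2l.
rewrite /kernel_model eqxx.
have LC : C^-1 <= C^-1 ^+ 2 by rewrite expr2 ler_peMl// ltW.
have CC2 : C^-1 ^+ 2 * C ^+ 2 = 1 by rewrite -exprMn CC expr1n.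
have E (c : R) : c * z * (c * s) = c ^+ 2 * (z * s) by ring.
have F (c : R) : (c * z - c * s) ^+ 2 = c ^+ 2 * (z - s) ^+ 2 by ring.
rewrite !E !F !invfM invr1 !mulr1; set L := C^-1 ^+ 2 in L1 LC CC2 hK *.
have C21 : C ^+ 2 <= C by rewrite expr2 ler_piMl// ltW.
have C20 : 0 < C ^+ 2 by rewrite exprn_gt0.
clearbody L; have LL : 1 <= L * L by rewrite mulr_ege1.
have LLzs := ler_wpM2r (ltW zs0) LL; have Lzs := ler_wpM2r (ltW zs0) L1.
have C2zs := ler_wpM2r (ltW zs0) (le_trans C21 C1).
have Lt : 1 <= L * tau by apply: (le_trans Ct); rewrite ler_wpM2r// ltW.
have g1 := ler_wpM2l e0 (le_trans wC LC); have g2 := ler_wpM2l e0 (le_trans C21 Cw).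
have CCzs : z * s = L * (C ^+ 2 * (z * s)) by rewrite [RHS]mulrA CC2 mul1r.
have Czs0 : 0 <= C ^+ 2 * (z * s) by rewrite mulr_ge0// ltW.
by split; apply: (hK _ _ _ _ _ _ 0) => //; lra.
Qed.

Lemma stable_model_time (alpha L : R) : 0 < alpha < 2 -> 1 <= L -> exists2 K : R, 0 < K &
  forall t t' z s, 0 < t -> 0 < t' -> 0 < z -> 0 < s -> t <= L * t' -> t' <= L * t ->
    kernel_model zeta alpha t z s <= K * kernel_model zeta alpha t' z s.
Proof.
move=> ha L1; have /andP[a0 a2] := ha; have L0 : 0 < L by lra.
rewrite /kernel_model lt_eqF//.
pose M := L `^ (2 / alpha); have M0 : 0 < M by rewrite powR_gt0.
have LM1 : 1 <= L + M by lra.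
have [K K0 hK] := stable_model_le hzeta ha LM1; exists K => // t t' z s t0 t'0 z0 s0 h1 h2.
have [T0 T1 T2] := stable_time_ge alpha z s t0.
have zs0 : 0 < z * s by rewrite mulr_gt0.
apply: hK => //; try nra.
apply: stable_timeP; first by nra.
apply: (@le_trans _ _ (M * t `^ (2 / alpha))); last by nra.
rewrite -powRM ?(ltW L0) ?(ltW t0)//; apply: ge0_ler_powR => //.
- by rewrite divr_ge0// ltW.
- by rewrite nnegrE ltW.
- by rewrite nnegrE mulr_ge0 ?ltW.
Qed.

Lemma stable_model_space (alpha c : R) : 0 < alpha < 2 -> 0 < c -> exists2 K : R, 0 < K &
  forall t z s, 0 < t -> 0 < z -> 0 < s ->
    kernel_model zeta alpha t (c * z) (c * s) <= K * kernel_model zeta alpha t z s /\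
    kernel_model zeta alpha t z s <= K * kernel_model zeta alpha t (c * z) (c * s).
Proof.
move=> ha c0; have /andP[a0 a2] := ha.
rewrite /kernel_model lt_eqF//.
pose a := c ^+ 2; pose b := a^-1.
have ca0 : 0 < a by rewrite exprn_gt0.
have b0 : 0 < b by rewrite invr_gt0.
have ba : b * a = 1 by rewrite mulVf ?gt_eqF.
have L1 : 1 <= 1 + a + b by lra.
have [K K0 hK] := stable_model_le hzeta ha L1; exists K => // t z s t0 z0 s0.
have E : c * z * (c * s) = a * (z * s) by rewrite /a; ring.
have F : (c * z - c * s) ^+ 2 = a * (z - s) ^+ 2 by rewrite /a; ring.
have [T0 T1 T2] := stable_time_ge alpha z s t0.
have [U0 U1 U2] := stable_time_ge alpha (c * z) (c * s) t0.
have cz0 : 0 < c * z by rewrite mulr_gt0.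
have cs0 : 0 < c * s by rewrite mulr_gt0.
rewrite F in U1; clearbody a b.
have zs0 : 0 <= z * s by rewrite mulr_ge0// ltW.
have f1 := mulr_ge0 (ltW ca0) (ltW t0); have f2 := mulr_ge0 (ltW b0) (ltW t0).
have f3 := mulr_ge0 (ltW ca0) zs0; have f4 := mulr_ge0 (ltW b0) zs0.
have f5 := mulr_ge0 (ltW ca0) f3; have f6 := mulr_ge0 (ltW ca0) (ltW T0).
have f7 := mulr_ge0 (ltW b0) (ltW T0); have f8 := mulr_ge0 (ltW ca0) (ltW U0).
have f9 := mulr_ge0 (ltW b0) (ltW U0).
have g1 := ler_wpM2l (ltW ca0) T1; have g2 := ler_wpM2l (ltW b0) U1.
rewrite mulrA ba mul1r in g2.
have g3 : b * (a * (z * s)) = z * s by rewrite [LHS]mulrA ba mul1r.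
by split; apply: hK => //; rewrite ?E ?F; first [by apply: stable_timeP; rewrite ?F; lra|lra].
Qed.

End ModelParts.

Lemma palphaC (R : realType) (alpha : R) (sigma : R -> R -> R) (zeta t r s : R) :
  palpha alpha sigma zeta t r s = palpha alpha sigma zeta t s r.
Proof.
have p2C : (fun tau => p2 zeta tau r s) = (fun tau => p2 zeta tau s r).
  by apply/funext => tau; rewrite /p2 [r * s]mulrC [r ^+ 2 + _]addrC.
pose F (f : R -> R) := if alpha == 2 then f t
  else fine (\int[@lebesgue_measure R]_(tau in `]0%R, +oo[) (f tau * sigma t tau)%:E)%E.
exact: (congr1 F p2C).
Qed.

Theorem theorem4p1 (R : realType) (zeta : R) (hzeta : - 2^-1 < zeta) :
  (* Part 1 *)
  ((forall C : R, 0 < C <= 1 ->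
      (exists c1 c2 K : R, [/\ 0 < c1, 0 < c2, 0 < K &
         forall z s tau : R, 0 < z -> 0 < s -> C <= tau <= C^-1 ->
           p2 zeta 1 (c1 * z) (c1 * s) <= K * p2 zeta tau z s /\
           p2 zeta tau z s <= K * p2 zeta 1 (c2 * z) (c2 * s)]) /\
      (forall (alpha : R) (sigma : R -> R -> R), 0 < alpha < 2 ->
         subordinator_density (alpha / 2) sigma ->
         exists K : R, 0 < K /\
           forall tau z s : R, C <= tau <= C^-1 -> 0 < z -> 0 < s ->
             palpha alpha sigma zeta tau z s <= K * palpha alpha sigma zeta 1 z s /\
             palpha alpha sigma zeta 1 z s <= K * palpha alpha sigma zeta tau z s)) /\
   (forall (alpha : R) (sigma : R -> R -> R), 0 < alpha < 2 ->
      subordinator_density (alpha / 2) sigma ->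
      forall c : R, 0 < c ->
      exists K : R, 0 < K /\
        forall tau z s : R, 0 < tau -> 0 < z -> 0 < s ->
          [/\ palpha alpha sigma zeta tau (c * z) (c * s)
                <= K * palpha alpha sigma zeta tau z s,
              palpha alpha sigma zeta tau z s
                <= K * palpha alpha sigma zeta tau (c * z) (c * s),
              palpha alpha sigma zeta (c * tau) z s
                <= K * palpha alpha sigma zeta tau z s &
              palpha alpha sigma zeta tau z s
                <= K * palpha alpha sigma zeta (c * tau) z s])) /\
  (* Part 2 *)
  ((forall C : R, 0 < C -> exists c : R, 0 < c /\
      forall (alpha : R) (sigma : R -> R -> R), admissible alpha sigma ->
      exists K : R, 0 < K /\
        forall tau z s : R, 0 < tau -> 0 < z -> z <= s / 2 ->
          palpha alpha sigma zeta tau z s <=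
            K * ((if C < tau then palpha alpha sigma zeta tau c (c * s) else 0)
                 + (if tau <= C then model_bound zeta alpha c tau s else 0))) /\
   (exists c : R, 0 < c /\
      forall (alpha : R) (sigma : R -> R -> R), admissible alpha sigma ->
      exists K : R, 0 < K /\
        forall tau z s : R, 0 < tau -> 0 < z -> z <= s / 2 ->
          palpha alpha sigma zeta tau z s <= K * model_bound zeta alpha c tau s) /\
   (forall (alpha : R) (sigma : R -> R -> R), admissible alpha sigma ->
      exists K : R, 0 < K /\
        forall tau z s : R, 0 < tau -> 0 < z -> z <= s / 2 ->
          palpha alpha sigma zeta tau z s <= K * s `^ (- (2 * zeta + 1)))) /\
  (* Part 3 *)
  (forall C : R, 0 < C -> exists c : R, 0 < c /\
     forall (alpha : R) (sigma : R -> R -> R), admissible alpha sigma ->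
     exists K : R, 0 < K /\
       forall tau z s : R, 0 < tau <= 1 -> 0 < z -> z <= s / 2 -> C <= s ->
         palpha alpha sigma zeta tau z s <= K * palpha alpha sigma zeta 1 c (c * s)) /\
  (* Part 4 *)
  (forall (alpha : R) (sigma : R -> R -> R), admissible alpha sigma ->
     exists c : R, 0 < c /\
       (exists K : R, 0 < K /\
          forall r s : R, 0 < r -> r <= s ->
            palpha alpha sigma zeta 1 1 s
              <= K * palpha alpha sigma zeta 1 (c * r) (c * s)) /\
       (exists K : R, 0 < K /\
          forall r s : R, 0 < r -> 0 < s ->
            Num.min (palpha alpha sigma zeta 1 1 r) (palpha alpha sigma zeta 1 1 s)
              <= K * palpha alpha sigma zeta 1 (c * r) (c * s))) /\
  (* Part 5 *)
  (forall (alpha : R) (sigma : R -> R -> R), admissible alpha sigma ->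
     exists c K : R, [/\ 0 < c, 0 < K &
       forall r s z t : R, 0 < r -> 0 < s -> 0 < z -> 0 < t ->
         `|r - s| / 2 < `|z - s| ->
         palpha alpha sigma zeta t z s <= K * palpha alpha sigma zeta t (c * r) (c * s)]).
Proof.
have a2le (alpha : R) : 0 < alpha < 2 -> 0 < alpha <= 2 by move=> /andP[-> /ltW].
have adm (alpha : R) (sigma : R -> R -> R) : 0 < alpha < 2 ->
    subordinator_density (alpha / 2) sigma -> admissible alpha sigma.
  by move=> ha hs; split=> //; exact: a2le.
split; last split; last split; last split.
- split.
    move=> C hC; have /andP[C0 C1] := hC.
    have CV0 : 0 < C^-1 by rewrite invr_gt0.
    split.
      have [K1 K10 h1] := gauss_time hzeta hC.
      have [K2 K20 h2] := p2_bounds hzeta.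
      exists C^-1, C, (K2 * K1 * K2); split=> //; first by rewrite !mulr_gt0.
      move=> z s tau z0 s0 ht; have t0 : 0 < tau.
        by case/andP: ht => /(lt_le_trans C0).
      have [] := h1 z s tau z0 s0 ht; rewrite /kernel_model eqxx => g1 g2.
      have [u1 u2] := h2 1 (C^-1 * z) (C^-1 * s) ltr01 (mulr_gt0 CV0 z0) (mulr_gt0 CV0 s0).
      have [v1 v2] := h2 tau z s t0 z0 s0.
      have [w1 w2] := h2 1 (C * z) (C * s) ltr01 (mulr_gt0 C0 z0) (mulr_gt0 C0 s0).
      rewrite -!mulrA; split.
        apply: (le_trans u1); rewrite ler_pM2l// (le_trans g1)// ler_pM2l//.
      by apply: (le_trans v1); rewrite ler_pM2l// (le_trans g2)// ler_pM2l.
    move=> alpha sigma ha hs; have [K1 K10 h1] := palpha_compare hzeta (adm _ _ ha hs).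
    have L1 : 1 <= C^-1 by rewrite invf_ge1.
    have [K2 K20 h2] := stable_model_time hzeta ha L1.
    exists (K1 * K2); split=> [|tau z s /andP[t1 t2] z0 s0]; first by rewrite mulr_gt0.
    have t0 : 0 < tau by exact: lt_le_trans t1.
    have Ct : 1 <= C^-1 * tau by rewrite -ler_pdivrMl ?invr_gt0// invrK mulr1.
    by split; apply: h1; rewrite ?(ltW K20)//; apply: h2 => //; rewrite mulr1.
  move=> alpha sigma ha hs c c0; have [K1 K10 h1] := palpha_compare hzeta (adm _ _ ha hs).
  have cV0 : 0 < c^-1 by rewrite invr_gt0.
  have L1 : 1 <= 1 + c + c^-1 by lra.
  have [K2 K20 h2] := stable_model_time hzeta ha L1.
  have [K3 K30 h3] := stable_model_space hzeta ha c0.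
  exists (K1 * (K2 + K3)); split=> [|tau z s t0 z0 s0]; first by rewrite mulr_gt0 ?addr_gt0.
  have K230 : 0 <= K2 + K3 by rewrite addr_ge0 ?ltW.
  have K2le x : 0 <= x -> K2 * x <= (K2 + K3) * x.
    by move=> x0; rewrite mulrDl lerDl mulr_ge0// ltW.
  have K3le x : 0 <= x -> K3 * x <= (K2 + K3) * x.
    by move=> x0; rewrite mulrDl lerDr mulr_ge0// ltW.
  have [g1 g2] := h3 tau z s t0 z0 s0.
  have ct0 : 0 < c * tau by rewrite mulr_gt0.
  have cz0 : 0 < c * z by rewrite mulr_gt0.
  have cs0 : 0 < c * s by rewrite mulr_gt0.
  have e1 : 0 <= tau by exact: ltW.
  have e2 : 0 <= c^-1 * tau by rewrite mulr_ge0 ?ltW.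
  have e3 : 0 <= c ^+ 2 * tau by rewrite mulr_ge0 ?sqr_ge0.
  have e4 : c^-1 * (c * tau) = tau by rewrite mulKf ?gt_eqF.
  have f1 : c * tau <= (1 + c + c^-1) * tau by rewrite !mulrDl; lra.
  have f2 : tau <= (1 + c + c^-1) * (c * tau) by rewrite !mulrDl e4; lra.
  have m0 (t r s' : R) : 0 < t -> 0 < r -> 0 < s' -> 0 <= kernel_model zeta alpha t r s'.
    by move=> *; rewrite ltW// kernel_model_gt0.
  split.
  + apply: (h1 _ _ _ _ _ _ _ K230 t0 cz0 cs0 t0 z0 s0).
    exact: le_trans g1 (K3le _ (m0 _ _ _ t0 z0 s0)).
  + apply: (h1 _ _ _ _ _ _ _ K230 t0 z0 s0 t0 cz0 cs0).
    exact: le_trans g2 (K3le _ (m0 _ _ _ t0 cz0 cs0)).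
  + apply: (h1 _ _ _ _ _ _ _ K230 ct0 z0 s0 t0 z0 s0).
    exact: le_trans (h2 _ _ _ _ ct0 t0 z0 s0 f1 f2) (K2le _ (m0 _ _ _ t0 z0 s0)).
  + apply: (h1 _ _ _ _ _ _ _ K230 t0 z0 s0 ct0 z0 s0).
    exact: le_trans (h2 _ _ _ _ t0 ct0 z0 s0 f2 f1) (K2le _ (m0 _ _ _ ct0 z0 s0)).
- have bound (alpha : R) (sigma : R -> R -> R) : admissible alpha sigma ->
      exists2 K : R, 0 < K & forall tau z s : R, 0 < tau -> 0 < z -> z <= s / 2 ->
        palpha alpha sigma zeta tau z s <= K * model_bound zeta alpha 32^-1 tau s.
    move=> ad; have [ha _] := ad.
    have [K1 K10 h1] := palpha_model hzeta ad.
    have [K2 K20 h2] := kernel_model_bound hzeta ha.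
    exists (K1 * K2) => [|tau z s t0 z0 zs]; first by rewrite mulr_gt0.
    have s0 : 0 < s by lra.
    apply: (le_trans (h1 tau z s t0 z0 s0).1).
    by rewrite -mulrA ler_pM2l// h2.
  split; last split.
  (* The dilation is an absolute constant; dependence on [C], [alpha] and [zeta] is confined to
     [K]. *)
  + move=> C C0; exists 32^-1; split=> // alpha sigma ad; have [ha _] := ad.
    have [K1 K10 h1] := bound _ _ ad.
    have [K2 K20 h2] := kernel_model_far hzeta ha C0.
    have [K3 K30 h3] := palpha_compare hzeta ad.
    exists (K1 + K3 * K2); split=> [|tau z s t0 z0 zs].
      by rewrite addr_gt0// mulr_gt0.
    have s0 : 0 < s by lra.
    have [tC|tC] := leP tau C.
      rewrite add0r; have := h1 tau z s t0 z0 zs.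
      have : 0 <= palpha alpha sigma zeta tau z s.
        have [K K0 hK] := palpha_model hzeta ad; have [_ g] := hK tau z s t0 z0 s0.
        by rewrite -(pmulr_rge0 _ K0); apply: le_trans g; rewrite ltW// kernel_model_gt0.
      move=> g0 g1; apply: (le_trans g1); rewrite mulrDl lerDl mulr_ge0//.
        by rewrite ltW// mulr_gt0.
      (* Nonnegativity of the bound, needed to enlarge its constant, follows from that of the kernel
         lying below it. *)
      by rewrite -(pmulr_rge0 _ K10) (le_trans g0).
    have c0 : 0 < 32^-1 * s by rewrite mulr_gt0.
    have i0 : 0 < 32^-1 :> R by [].
    rewrite addr0; have := h3 K2 tau z s tau 32^-1 (32^-1 * s) (ltW K20) t0 z0 s0 t0 i0 c0 (h2 _ _ _ tC z0 zs).
    move=> g; have : 0 <= palpha alpha sigma zeta tau 32^-1 (32^-1 * s).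
      have [K K0 hK] := palpha_model hzeta ad; have [_ g'] := hK tau _ _ t0 i0 c0.
      by rewrite -(pmulr_rge0 _ K0); apply: le_trans g'; rewrite ltW// kernel_model_gt0.
    by move=> g0; apply: (le_trans g); rewrite mulrDl lerDr mulr_ge0// ltW.
  + exists 32^-1; split=> // alpha sigma /bound[K K0 hK]; by exists K.
  + move=> alpha sigma ad; have [ha _] := ad.
    have [K1 K10 h1] := bound _ _ ad.
    have [K2 K20 h2] := model_bound_le hzeta ha.
    exists (K1 * K2); split=> [|tau z s t0 z0 zs]; first by rewrite mulr_gt0.
    have s0 : 0 < s by lra.
    apply: (le_trans (h1 tau z s t0 z0 zs)).
    by rewrite -mulrA ler_pM2l// h2.
- move=> C C0; exists 32^-1; split=> // alpha sigma ad; have [ha _] := ad.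
  have [K1 K10 h1] := kernel_model_short hzeta ha C0.
  have [K2 K20 h2] := palpha_compare hzeta ad.
  exists (K2 * K1); split=> [|tau z s ht z0 zs sC]; first by rewrite mulr_gt0.
  have s0 : 0 < s by lra.
  have /andP[t0 _] := ht.
  by apply: h2; rewrite ?(ltW K10) ?mulr_gt0//; exact: h1.
- move=> alpha sigma ad; have [ha _] := ad; exists 2^-1; split=> //.
  have [K1 K10 h1] := kernel_model_min hzeta ha.
  have [K2 K20 h2] := palpha_compare hzeta ad.
  have main (r s : R) : 0 < r -> r <= s -> palpha alpha sigma zeta 1 1 s <=
      K2 * K1 * palpha alpha sigma zeta 1 (2^-1 * r) (2^-1 * s).
    move=> r0 rs; have s0 : 0 < s by exact: lt_le_trans rs.
    by apply: h2; rewrite ?(ltW K10) ?mulr_gt0//; exact: h1.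
  have K0 : 0 < K2 * K1 by rewrite mulr_gt0.
  split; exists (K2 * K1); split=> // r s r0 s0.
  have minl (x y : R) : Num.min x y <= x by rewrite ge_min lexx.
  have minr (x y : R) : Num.min x y <= y by rewrite ge_min lexx orbT.
  (* The minimum is bounded by its entry at the larger of the two points; symmetry of the kernel
     covers the case [s <= r]. *)
  have [rs|/ltW rs] := leP r s; first exact: le_trans (minr _ _) (main r s r0 rs).
  have := main s r s0 rs; rewrite (palphaC _ _ _ _ (2^-1 * s)).
  exact: le_trans (minl _ _).
- move=> alpha sigma ad; have [ha _] := ad.
  have [K1 K10 h1] := kernel_model_near hzeta ha.
  have [K2 K20 h2] := palpha_compare hzeta ad.
  exists 4^-1, (K2 * K1); split=> //; first by rewrite mulr_gt0.
  move=> r s z t r0 s0 z0 t0 h.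
  by apply: h2; rewrite ?(ltW K10) ?mulr_gt0//; exact: h1.
Qed.
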